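(* Let $T:\mathbb{C}[z]\to\mathbb{C}[z]$ be a linear operator, let $\mu>0$, and let $H_1=\{z\in\mathbb{C}:\operatorname{Im} z>\mu\}$. Then $T$ preserves $\mathcal{S}_\mu$, i.e. $T(\mathcal{S}_\mu)\subseteq\mathcal{S}_\mu\cup\{0\}$, if and only if either (i) $T$ has range of dimension at most one and is of the form $T[f]=\alpha(f)p$ for $f\in\mathbb{C}[z]$, where $\alpha:\mathbb{C}[z]\to\mathbb{C}$ is a linear functional and $p\in\mathcal{P}(H_1\cup H_1^* )$; or (ii) $T$ satisfies both (a) and (b): (a) $e^{i\mu w}\overline{G}_T(z,w)\in\overline{\mathcal{P}}(H_1\times H)$ or $e^{-i\mu w}\overline{G}_T(z,w)\in\overline{\mathcal{P}}(H_1\times H^* )$; (b) $e^{i\mu w}\overline{G}_T(z,w)\in\overline{\mathcal{P}}(H_1^*\times H)$ or $e^{-i\mu w}\overline{G}_T(z,w)\in\overline{\mathcal{P}}(H_1^*\times H^* )$.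
   Context: $H=\{z\in\mathbb{C}:\operatorname{Im}z>0\}$, and for $\Omega\subseteq\mathbb{C}$, $\Omega^*=\{\bar\zeta:\zeta\in\Omega\}$. For $\Omega\subseteq\mathbb{C}^m$, $\mathcal{P}(\Omega)$ is the set of polynomials in $m$ complex variables with no zeros in $\Omega$, and $\overline{\mathcal{P}}(\Omega)$ is the closure of $\mathcal{P}(\Omega)$ under uniform limits on compact subsets of $\mathbb{C}^m$ (a set of entire functions). $\mathcal{S}_\mu=\mathcal{P}(\{z:|\operatorname{Im}z|>\mu\})$ is the set of complex polynomials whose zeros all lie in $|\operatorname{Im}z|\le\mu$. The symbol of $T$ is the formal power series $\overline{G}_T(z,w)=T(e^{-zw})=\sum_{k\ge0}\frac{(-1)^kw^k}{k!}T(z^k)\in\mathbb{C}[z][[w]]$; membership of a formal power series in $\overline{\mathcal{P}}(\cdot)$ means that it defines an entire function in that class. *)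

(* Defs.v *)
From HB Require Import structures.
From mathcomp Require Import all_boot all_order all_algebra.
From mathcomp Require Import all_classical all_reals all_analysis.
From mathcomp.real_closed Require Import complex.

Set Implicit Arguments.
Unset Strict Implicit.
Unset Printing Implicit Defensive.

Import Order.TTheory GRing.Theory Num.Theory.
Import numFieldNormedType.Exports.

Local Open Scope classical_set_scope.
Local Open Scope ring_scope.

(* R[i] has no topology of its own in the library: the topology of the norm is
   the one carried by R[i]^o, which is convertible to R[i]. *)

Section Defs.
Variable R : realType.
Local Notation C := R[i].

Definition upper_half : set C := [set z : C | 0 < complex.Im z].

Definition upper_half_gt (mu : R) : set C := [set z : C | mu < complex.Im z].

Definition conj_set (Omega : set C) : set C := [set conjc z | z in Omega].

Definition noroots (Omega : set C) : set {poly C} :=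
  [set p | forall z, Omega z -> ~~ root p z].

(* A polynomial in (z, w) is an element of C[z][w]: the outer variable is w. *)
Definition eval2 (p : {poly {poly C}}) (zw : C^o * C^o) : C^o :=
  p.[(zw.2 : C)%:P].[zw.1].

Definition noroots2 (Omega : set (C * C)) : set {poly {poly C}} :=
  [set p | forall zw, Omega zw -> eval2 p zw != 0].

Definition noroots2_bar (Omega : set (C * C)) : set (C^o * C^o -> C^o) :=
  [set f | exists2 p : nat -> {poly {poly C}},
     (forall n, noroots2 Omega (p n)) &
     {family compact, (fun n => eval2 (p n)) @ \oo --> f}].

Definition S_strip (mu : R) : set {poly C} :=
  noroots [set z : C | mu < `|complex.Im z|].

(* Formal power series in w over C[z], given by their coefficients. *)
Definition fps := nat -> {poly C}.

Definition fps_mul (g h : fps) : fps :=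
  fun n => \sum_(k < n.+1) g k * h (n - k)%N.

(* e^{c w} *)
Definition fps_exp (c : C) : fps := fun n => (c ^+ n / (n`!)%:R)%:P.

Definition symbol (T : {poly C} -> {poly C}) : fps :=
  fun k => ((-1) ^+ k / (k`!)%:R) *: T 'X^k.

(* A limit f of polynomials, uniform on compact sets, is entire; by uniqueness
   of the expansion in powers of w, pointwise convergence of the series to f
   then means that the series is the power series expansion of f. *)
Definition fps_in_bar (g : fps) (Omega : set (C * C)) : Prop :=
  exists2 f : C^o * C^o -> C^o, noroots2_bar Omega f &
    forall z w : C,
      series (fun k => (g k).[z] * w ^+ k : C^o) @ \oo --> f (z, w).

Definition range_dim_le1 (T : {poly C} -> {poly C}) : Prop :=
  exists q : {poly C}, forall f, exists c : C, T f = c *: q.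

End Defs.

(* Main.v *)
(** Put rho = T (x f) / T f, so that T ((x - a) f) = (rho - a) T f.

    Suppose T preserves S_mu. If T kills polynomials f of arbitrarily large
    degree with all zeros in the open strip, then f + k g is in S_mu for small
    k and any g of degree at most deg f, so that k T g = T (f + k g) is in S_mu
    or zero: every polynomial in the range is zero or free of zeros off the
    strip, and the range has dimension at most one.  Otherwise, for f with at
    least N zeros, all in the open strip, rho is defined off the closed strip
    and avoids the open strip; by connectedness it stays on one side.
    Consequently T f (z) remains nonzero when all but N zeros of f are moved
    into the half-plane on the other side, and the polynomials
    T_x ((1 - (x -+ i mu) w / n)^n (1 - x / n)^N) have no zeros in the product
    of half-planes.  They converge to e^(+- i mu w) G: Szasz's inequality in w
    bounds the coefficients for z near one point, and as rho maps a half-plane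
    into a half-plane it grows at most linearly, so deg T x^k <= k + const and
    the bounds spread to all z.

    Conversely T f = phi (- d/dw) F at w = 0, where F = e^(+- i mu w) G and
    phi y = f (y +- i mu).  If the zeros of phi are in the open half-plane
    opposite to that of w, then phi (- d/dw) preserves the absence of zeros in
    the latter; one shifts the zeros of f slightly, evaluates at w near 0, and
    passes to the limit with Hurwitz's theorem. *)
Require Import Defs.
From HB Require Import structures.
From mathcomp Require Import all_boot all_order all_algebra.
From mathcomp Require Import all_classical all_reals all_analysis.
From mathcomp.real_closed Require Import complex polyrcf.
From mathcomp Require Import cyclic separable cyclotomic.
From mathcomp Require Import ring lra zify.

Set Implicit Arguments.
Unset Strict Implicit.
Unset Printing Implicit Defensive.

Import Order.TTheory GRing.Theory Num.Theory.
Import numFieldNormedType.Exports.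
Local Open Scope classical_set_scope.
Local Open Scope ring_scope.

(** * The modulus of a complex number *)

Section Modulus.
Variable R : realType.
Local Notation C := R[i].
Implicit Types (z w : C) (r : R).

(** The norm of [R[i]] takes its values in [R[i]]. A real-valued modulus gives access to the order
    of [R] and to its decision procedures. *)
Definition cabs z : R := ComplexField.Normc.normc z.

Lemma normCE z : `|z| = (cabs z)%:C%C.
Proof. by case: z. Qed.

Lemma cabs_sqr z : cabs z ^+ 2 = complex.Re z ^+ 2 + complex.Im z ^+ 2.
Proof. by case: z => a b; rewrite /cabs /= sqr_sqrtr// addr_ge0// sqr_ge0. Qed.

Lemma cabs_ge0 z : 0 <= cabs z.
Proof. by case: z => a b; exact: sqrtr_ge0. Qed.

Lemma cabs0 : cabs 0 = 0. Proof. exact: ComplexField.Normc.normc0. Qed.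
Lemma cabs1 : cabs 1 = 1. Proof. exact: ComplexField.Normc.normc1. Qed.

Lemma cabs_eq0 z : (cabs z == 0) = (z == 0).
Proof.
apply/eqP/eqP => [|->]; last exact: cabs0.
exact: ComplexField.Normc.eq0_normc.
Qed.

Lemma cabs_gt0 z : (0 < cabs z) = (z != 0).
Proof. by rewrite lt_def cabs_eq0 cabs_ge0 andbT. Qed.

Lemma cabsM z w : cabs (z * w) = cabs z * cabs w.
Proof. exact: ComplexField.Normc.normcM. Qed.

Lemma cabsV z : cabs z^-1 = (cabs z)^-1.
Proof. exact: ComplexField.Normc.normcV. Qed.

Lemma cabsN z : cabs (- z) = cabs z.
Proof. by rewrite -mulN1r cabsM /cabs /= oppr0 sqrrN expr1n expr0n addr0 sqrtr1 mul1r. Qed.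

Lemma cabsD z w : cabs (z + w) <= cabs z + cabs w.
Proof. exact: le_normcD. Qed.

Lemma cabsB z w : cabs (z - w) <= cabs z + cabs w.
Proof. by rewrite -(cabsN w) cabsD. Qed.

Lemma cabs_distC z w : cabs (z - w) = cabs (w - z).
Proof. by rewrite -cabsN opprB. Qed.

Lemma cabs_lower z w : cabs z - cabs w <= cabs (z + w).
Proof. by have := cabsB (z + w) w; rewrite addrK; lra. Qed.

Lemma cabsX z n : cabs (z ^+ n) = cabs z ^+ n.
Proof. by elim: n => [|n IH]; rewrite ?expr0 ?cabs1// !exprS cabsM IH. Qed.

Lemma cabs_real r : cabs r%:C%C = `|r|.
Proof. by rewrite /cabs /= expr0n addr0 sqrtr_sqr. Qed.

Lemma cabs_nat n : cabs n%:R = n%:R.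
Proof. by rewrite -(rmorph_nat (real_complex R)) cabs_real ger0_norm. Qed.

Lemma cabs_imag r : cabs (0 +i* r)%C = `|r|.
Proof. by rewrite /cabs /= expr0n add0r sqrtr_sqr. Qed.

Lemma cabs_Re z : `|complex.Re z| <= cabs z.
Proof.
rewrite -(ler_pXn2r (n := 2)) ?nnegrE ?cabs_ge0// cabs_sqr real_normK ?num_real//.
by rewrite lerDl sqr_ge0.
Qed.

Lemma cabs_Im z : `|complex.Im z| <= cabs z.
Proof.
rewrite -(ler_pXn2r (n := 2)) ?nnegrE ?cabs_ge0// cabs_sqr real_normK ?num_real//.
by rewrite lerDr sqr_ge0.
Qed.

Lemma cabs_ReIm z : cabs z <= `|complex.Re z| + `|complex.Im z|.
Proof.
rewrite -(ler_pXn2r (n := 2)) ?nnegrE ?cabs_ge0 ?addr_ge0// cabs_sqr.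
rewrite sqrrD !real_normK ?num_real//.
by rewrite lerD2r lerDl mulrn_wge0// mulr_ge0.
Qed.

Lemma cabs_sum (I : Type) (s : seq I) (P : pred I) (F : I -> C) :
  cabs (\sum_(i <- s | P i) F i) <= \sum_(i <- s | P i) cabs (F i).
Proof.
elim/big_ind2: _ => [|x1 x2 y1 y2 h1 h2|//]; first by rewrite cabs0.
by rewrite (le_trans (cabsD _ _))// lerD.
Qed.

Lemma cabs_prod (I : Type) (s : seq I) (P : pred I) (F : I -> C) :
  cabs (\prod_(i <- s | P i) F i) = \prod_(i <- s | P i) cabs (F i).
Proof. by elim/big_rec2: _ => [|i x y _ <-]; rewrite ?cabs1 ?cabsM. Qed.

Lemma cImD z w : complex.Im (z + w) = complex.Im z + complex.Im w.
Proof. by case: z w => [a b] [c d]. Qed.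
Lemma cReD z w : complex.Re (z + w) = complex.Re z + complex.Re w.
Proof. by case: z w => [a b] [c d]. Qed.
Lemma cImN z : complex.Im (- z) = - complex.Im z.
Proof. by case: z. Qed.
Lemma cReN z : complex.Re (- z) = - complex.Re z.
Proof. by case: z. Qed.
Lemma cImM z w :
  complex.Im (z * w) = complex.Re z * complex.Im w + complex.Im z * complex.Re w.
Proof. by case: z w => [a b] [c d]. Qed.
Lemma cReM z w :
  complex.Re (z * w) = complex.Re z * complex.Re w - complex.Im z * complex.Im w.
Proof. by case: z w => [a b] [c d]. Qed.

Lemma cReV z : complex.Re z^-1 = complex.Re z / cabs z ^+ 2.
Proof. by rewrite cabs_sqr; case: z. Qed.
Lemma cImV z : complex.Im z^-1 = - complex.Im z / cabs z ^+ 2.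
Proof. by rewrite cabs_sqr mulNr; case: z. Qed.

Lemma cRe_sum (I : Type) (s : seq I) (P : pred I) (F : I -> C) :
  complex.Re (\sum_(i <- s | P i) F i) = \sum_(i <- s | P i) complex.Re (F i).
Proof. by elim/big_rec2: _ => [//|i x y _ <-]; rewrite cReD. Qed.

Lemma cIm_sum (I : Type) (s : seq I) (P : pred I) (F : I -> C) :
  complex.Im (\sum_(i <- s | P i) F i) = \sum_(i <- s | P i) complex.Im (F i).
Proof. by elim/big_rec2: _ => [//|i x y _ <-]; rewrite cImD. Qed.

Lemma complex_eta z : z = (complex.Re z)%:C%C + (0 +i* complex.Im z)%C.
Proof. by case: z => a b; rewrite /GRing.add /= addr0 add0r. Qed.

End Modulus.


(** * Complex polynomials on discs *)

Section PolyDisc.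
Variable R : realType.
Local Notation C := R[i].
Implicit Types (z w : C) (r : R) (p q : {poly C}).

Lemma prim_root_exists n : (0 < n)%N -> exists w : C, n.-primitive_root w.
Proof.
move=> n_gt0; have [r Dp] := closed_field_poly_normal ('X^n - 1 : {poly C}).
rewrite (monicP _) ?monicXnsubC // scale1r in Dp.
have rn1: all n.-unity_root r by apply/allP=> z; rewrite -root_prod_XsubC -Dp.
have sz_r: (n < (size r).+1)%N.
  by rewrite -(size_prod_XsubC r id) -Dp size_XnsubC.
have [|z] := hasP (has_prim_root n_gt0 rn1 _ sz_r); last by exists z.
by rewrite -separable_prod_XsubC -Dp separable_Xn_sub_1 // pnatr_eq0 -lt0n.
Qed.

Lemma cabs_prim_root n w : n.-primitive_root w -> cabs w = 1.
Proof.
move=> prim_w; apply/eqP; rewrite -(@pexpr_eq1 _ _ n) ?cabs_ge0//.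
  by rewrite -cabsX (prim_expr_order prim_w) cabs1.
exact: prim_order_gt0 prim_w.
Qed.

Lemma sum_prim_root n w j : n.-primitive_root w ->
  \sum_(i < n) (w ^+ i) ^+ j = if (n %| j)%N then n%:R else 0.
Proof.
move=> prim_w; under eq_bigr => i _ do rewrite -exprM mulnC exprM.
case: ifPn => [|ndvd].
  rewrite (prim_order_dvd prim_w) => /eqP ->.
  by under eq_bigr => i _ do rewrite expr1n; rewrite sumr_const card_ord.
have wj1 : w ^+ j != 1 by rewrite -(prim_order_dvd prim_w).
apply/(mulfI (x := w ^+ j - 1)); first by rewrite subr_eq0.
by rewrite mulr0 -subrX1 -exprM mulnC exprM (prim_expr_order prim_w) expr1n subrr.
Qed.

(* Average p(r w) w^(-k) over the m-th roots of unity w, m > deg p + k. *)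
Lemma cauchy_estimate p r M k : 0 <= r ->
  (forall z, cabs z = r -> cabs p.[z] <= M) -> cabs p`_k * r ^+ k <= M.
Proof.
move=> r0 hp; set n := (size p + k).+1.
have [w prim_w] := prim_root_exists (isT : (0 < n)%N).
have w1 := cabs_prim_root prim_w.
have nC : (n%:R : C) != 0 by rewrite pnatr_eq0.
have -> : cabs p`_k * r ^+ k = cabs (p`_k * r%:C%C ^+ k).
  by rewrite cabsM cabsX cabs_real ger0_norm.
(* The exponent n - k stands for -k, the [w ^+ i] being n-th roots of unity. *)
have -> : p`_k * r%:C%C ^+ k =
    n%:R^-1 * \sum_(i < n) (w ^+ i) ^+ (n - k) * p.[r%:C%C * w ^+ i].
  apply: (mulfI nC); rewrite mulVKf//.
  transitivity (\sum_(j < size p)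
      p`_j * r%:C%C ^+ j * \sum_(i < n) (w ^+ i) ^+ (j + (n - k))); last first.
    under [RHS]eq_bigr => i _ do rewrite horner_coef mulr_sumr.
    rewrite exchange_big; apply: eq_bigr => j _; rewrite mulr_sumr.
    by apply: eq_bigr => i _; rewrite exprMn exprD; ring.
  (* Since 0 < j + (n - k) < 2n, divisibility by n forces equality with n. *)
  have jE (j : 'I_(size p)) : (n %| j + (n - k))%N = (j == k :> nat).
    have jp := ltn_ord j; apply/idP/eqP => [/dvdnP[q hq]|->]; last first.
      by rewrite subnKC ?dvdnn// /n; lia.
    have : (0 < q * n < 2 * n)%N by rewrite -hq /n; lia.
    by move=> /andP[]; case: q hq => [|[|q]] hq; rewrite /n in hq *; lia.
  under eq_bigr => j _ do rewrite sum_prim_root// jE.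
  case: (ltnP k (size p)) => [kp|pk]; last first.
    rewrite nth_default// mul0r mulr0 big1// => j _.
    by rewrite ltn_eqF ?mulr0// (leq_trans (ltn_ord j)).
  rewrite (bigD1 (Ordinal kp))//= eqxx big1 ?addr0 1?mulrC// => j jk.
  by case: eqP => [e|]; rewrite ?mulr0//; case/negP: jk; apply/eqP/val_inj.
rewrite cabsM cabsV cabs_nat.
rewrite mulrC ler_pdivrMr ?ltr0n//.
apply: (le_trans (cabs_sum _ _ _)).
have -> : M * n%:R = \sum_(i < n) M by rewrite sumr_const card_ord mulr_natr.
apply: ler_sum => i _; rewrite cabsM !cabsX w1 !expr1n mul1r hp//.
by rewrite cabsM cabsX w1 expr1n mulr1 cabs_real ger0_norm.
Qed.

Lemma normal_form p : p != 0 ->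
  exists2 rs : seq C, p = lead_coef p *: \prod_(a <- rs) ('X - a%:P) &
    forall a, (a \in rs) = root p a.
Proof.
move=> p0; have [rs Dp] := closed_field_poly_normal p; exists rs => // a.
by rewrite Dp rootZ ?lead_coef_eq0// root_prod_XsubC.
Qed.

Lemma cabs_horner_prod (c : C) (rs : seq C) z :
  cabs (c *: \prod_(a <- rs) ('X - a%:P)).[z] =
    cabs c * \prod_(a <- rs) cabs (z - a).
Proof.
rewrite hornerZ cabsM horner_prod cabs_prod; congr (_ * _).
by apply: eq_bigr => a _; rewrite !hornerE.
Qed.

(** By Bernoulli's inequality the powers of a number above 1 grow at least linearly. *)
Lemma bernoulli_le1 (x K : R) : (forall n, x ^+ n <= K) -> x <= 1.
Proof.
move=> h; rewrite leNgt; apply/negP => x1.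
have y0 : 0 < x - 1 by lra.
have bern m : 1 + (x - 1) *+ m <= x ^+ m.
  elim: m => [|m IH]; first by rewrite mulr0n addr0 expr0.
  rewrite exprS mulrS.
  have t0 : 0 <= (x - 1) *+ m by rewrite mulrn_wge0// ltW.
  set t := (x - 1) *+ m in IH t0 *; nra.
have hK : 0 <= `|K| / (x - 1) by rewrite divr_ge0// ltW.
have := archi_boundP hK; set m := Num.bound _ => hm.
have := le_trans (bern m) (h m); rewrite -mulr_natr.
move: hm; rewrite ltr_pdivrMr// => hm; have := ler_norm K; nra.
Qed.

(* Over the n-th roots of unity u, the product of the p(z0 + r u) is
   p(z0)^n times the product over the zeros a of 1 - (r/(a - z0))^n, up to sign;
   so m^n <= |p(z0)|^n 2^deg for all n. *)
Lemma min_modulus p z0 r m : 0 <= r -> 0 <= m ->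
  (forall z, cabs (z - z0) < r -> ~~ root p z) ->
  (forall z, cabs (z - z0) = r -> m <= cabs p.[z]) -> m <= cabs p.[z0].
Proof.
move=> r0 m0 hroot hm.
have [p0|p0] := eqVneq p 0.
  by have := hm (z0 + r%:C%C); rewrite p0 !horner0 addrAC subrr add0r cabs_real ger0_norm//; apply.
have [rs Dp hrs] := normal_form p0.
have hr a : a \in rs -> r <= cabs (z0 - a).
  move=> ain; rewrite leNgt; apply/negP; rewrite cabs_distC => /hroot.
  by rewrite -hrs ain.
set c := lead_coef p in Dp.
have hD z : cabs p.[z] = cabs c * \prod_(a <- rs) cabs (z - a).
  by rewrite {1}Dp cabs_horner_prod.
have key n : (0 < n)%N -> m ^+ n <= cabs p.[z0] ^+ n * 2 ^+ size rs.
  move=> n0; have [w prim_w] := prim_root_exists n0.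
  have w1 := cabs_prim_root prim_w.
  have E1 : m ^+ n <= \prod_(0 <= i < n) cabs p.[z0 + r%:C%C * w ^+ i].
    have -> : m ^+ n = \prod_(0 <= i < n) m by rewrite prodr_const_nat subn0.
    apply: ler_prod => i _; rewrite m0 hm// addrAC subrr add0r cabsM cabsX w1.
    by rewrite expr1n mulr1 cabs_real ger0_norm.
  apply: (le_trans E1).
  (* This is the factorization of X^n - 1 over the roots of unity, taken at (a - z0) / r; hence the
     separate case r = 0. *)
  have E2 a : \prod_(0 <= i < n) (z0 + r%:C%C * w ^+ i - a) =
      (-1) ^+ n * ((a - z0) ^+ n - r%:C%C ^+ n).
    have [->|rn0] := eqVneq r 0.
      rewrite expr0n eqn0Ngt n0 subr0 -exprMn mulN1r opprB.
      by under eq_bigr do rewrite mul0r addr0; rewrite prodr_const_nat subn0.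
    have rC : r%:C%C != 0 :> C by rewrite (fmorph_eq0 (real_complex R)).
    have e (x : C) : \prod_(0 <= i < n) ('X - (w ^+ i)%:P).[x] = x ^+ n - 1.
      by rewrite -horner_prod factor_Xn_sub_1// !hornerE.
    have -> : (a - z0) ^+ n - r%:C%C ^+ n =
        r%:C%C ^+ n * (((a - z0) / r%:C%C) ^+ n - 1).
      by rewrite mulrBr mulr1 -exprMn mulrC divfK.
    have cst (x : C) : x ^+ n = \prod_(0 <= i < n) x.
      by rewrite prodr_const_nat subn0.
    rewrite -e !cst -!big_split /=; apply: eq_bigr => i _.
    rewrite !hornerE; change (z0 + r%:C%C * w ^+ i - a =
      -1 * r%:C%C * ((a - z0) / r%:C%C - w ^+ i)).
    by field.
  under eq_bigr => i _ do rewrite hD.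
  rewrite hD big_split /= prodr_const_nat subn0 exprMn -mulrA.
  rewrite ler_wpM2l ?exprn_ge0 ?cabs_ge0// exchange_big /=.
  under eq_bigr => a _ do rewrite -cabs_prod E2.
  (* Each zero contributes at most 2 |z0 - a|^n, because r <= |z0 - a|. *)
  elim: (rs) hr => [|a s IH] hr.
    by rewrite !big_nil expr1n mulr1.
  rewrite !big_cons exprMn /= exprS mulrACA.
  apply: ler_pM; rewrite ?cabs_ge0 ?prodr_ge0 //; first by move=> b _; exact: cabs_ge0.
    rewrite cabsM cabsX cabsN cabs1 expr1n mul1r.
    apply: (le_trans (cabsB _ _)); rewrite !cabsX cabs_real (ger0_norm r0).
    rewrite [cabs (z0 - a)]cabs_distC mulr_natr mulr2n lerD2l.
    rewrite lerXn2r ?nnegrE ?cabs_ge0// cabs_distC; exact: hr (mem_head _ _).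
  by apply: IH => b bs; rewrite hr// in_cons bs orbT.
rewrite leNgt; apply/negP => ltm.
have m1 : 0 < m by rewrite (le_lt_trans (cabs_ge0 _) ltm).
have pz0 : 0 < cabs p.[z0].
  rewrite lt_def cabs_ge0 andbT; apply/eqP => h0.
  by have := key _ (isT : (0 < 1)%N); rewrite h0 expr1 mul0r; lra.
have : m / cabs p.[z0] <= 1.
  apply: (@bernoulli_le1 _ (2 ^+ size rs)) => [[|n]].
    by rewrite expr0 exprn_ege1// ler1n.
  by rewrite exprMn exprVn mulrC ler_pdivrMl ?exprn_gt0// key.
by rewrite ler_pdivrMr// mul1r leNgt ltm.
Qed.

End PolyDisc.


(** * Zero-free polynomials: lower bounds, Hurwitz's theorem, Szasz's inequality *)

Section PolyBounds.
Variable R : realType.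
Local Notation C := R[i].
Implicit Types (z w : C) (r : R) (p q f g h : {poly C}).

(** Every zero is at distance at least d from z0, hence at least d/2 from the points of the smaller
    disc; multiply over the zeros. *)
Lemma poly_lower_bound p z0 (d : R) : 0 < d ->
  (forall z, cabs (z - z0) < d -> ~~ root p z) ->
  exists2 m, 0 < m & forall z, cabs (z - z0) <= d / 2 -> m <= cabs p.[z].
Proof.
move=> d0 hroot.
have p0 : p != 0.
  apply/eqP => p0; have := hroot z0; rewrite subrr cabs0 p0 root0.
  by move=> /(_ d0).
have [rs Dp hrs] := normal_form p0; set c := lead_coef p in Dp.
have c0 : 0 < cabs c by rewrite cabs_gt0 lead_coef_eq0.
exists (cabs c * (d / 2) ^+ size rs).
  by rewrite mulr_gt0// exprn_gt0// divr_gt0.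
move=> z hz; rewrite Dp cabs_horner_prod ler_wpM2l ?cabs_ge0//.
have : all (root p) rs by apply/allP => a; rewrite hrs.
elim: (rs) => [|a s IH] /=; first by rewrite big_nil expr0.
move=> /andP[ra /IH{}IH]; rewrite big_cons exprS ler_pM//; first lra.
  by rewrite exprn_ge0//; lra.
have : d <= cabs (a - z0) by rewrite leNgt; apply/negP => /hroot; rewrite ra.
have := cabsD (a - z) (z - z0); rewrite (_ : a - z + _ = a - z0); last by ring.
by rewrite (cabs_distC a z); lra.
Qed.

(** Applied to the distances from a point to the zeros of a polynomial, it yields a circle that
    passes through none of them. *)
Lemma small_radius (s : seq R) (d : R) : 0 < d ->
  exists r, [/\ 0 < r, r < d & forall x, x \in s -> 0 < x -> r < x].
Proof.
move=> d0; elim: s => [|x s [r [r0 rd hr]]].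
  by exists (d / 2); split => //; lra.
have [x0|x0] := ltP 0 x; last first.
  exists r; split => // y; rewrite in_cons => /orP[/eqP ->|]; first by lra.
  exact: hr.
exists (Num.min r (x / 2)); split.
- by rewrite lt_min r0/=; lra.
- by rewrite gt_min rd.
- move=> y; rewrite in_cons gt_min => /orP[/eqP ->|ys y0].
    by move=> _; apply/orP; right; lra.
  by rewrite hr.
Qed.

(** On a small circle missing the zeros of h one has |h| >= m > 0. If q is within m/3 of h, then |q|
    >= 2m/3 on the circle, and by the minimum modulus principle at z0 as well, whereas h(z0) = 0
    gives |q(z0)| <= m/3. *)
Lemma hurwitz h z0 (d : R) : 0 < d -> h != 0 -> root h z0 ->
  exists2 eta, 0 < eta & forall q,
    (forall z, cabs (z - z0) < d -> ~~ root q z) ->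
    ~ (forall z, cabs (z - z0) < d -> cabs (q.[z] - h.[z]) <= eta).
Proof.
move=> d0 h0 hz0.
have [rs Dp hrs] := normal_form h0; set c := lead_coef h in Dp.
have c0 : 0 < cabs c by rewrite cabs_gt0 lead_coef_eq0.
have [r [r0 rd hr]] := small_radius [seq cabs (a - z0) | a <- rs] d0.
pose m := cabs c * \prod_(a <- rs) `|r - cabs (a - z0)|.
have m0 : 0 < m.
  rewrite /m mulr_gt0// big_seq prodr_gt0// => a ain; rewrite normr_gt0 subr_eq0.
  apply/eqP => e; have := hr _ (map_f (fun a => cabs (a - z0)) ain).
  by rewrite -e ltxx => /(_ r0).
have hm z : cabs (z - z0) = r -> m <= cabs h.[z].
  move=> hz; rewrite Dp cabs_horner_prod ler_wpM2l ?cabs_ge0//.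
  apply: ler_prod => a _; rewrite normr_ge0 /= ler_norml.
  have e1 : z - a = (z - z0) - (a - z0) by ring.
  have := cabs_lower (z - z0) (- (a - z0)); rewrite -e1 cabsN hz => h1.
  have := cabs_lower (a - z0) (- (z - z0)); rewrite cabsN hz.
  have -> : a - z0 - (z - z0) = a - z by ring.
  by rewrite (cabs_distC a z); lra.
exists (m / 3); first by lra.
move=> q hq hclose.
have := @min_modulus R q z0 r (2 / 3 * m) (ltW r0).
have m23 : 0 <= 2 / 3 * m by lra.
have hq' z : cabs (z - z0) < r -> ~~ root q z.
  by move=> hz; rewrite hq// (lt_trans hz).
move=> /(_ m23 hq').
have hq'' z : cabs (z - z0) = r -> 2 / 3 * m <= cabs q.[z].
  move=> hz; have := hclose z; rewrite hz => /(_ rd); have := hm z hz.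
  have := cabs_lower h.[z] (q.[z] - h.[z]).
  by rewrite (_ : h.[z] + _ = q.[z]); [lra | ring].
move=> /(_ hq'').
have := hclose z0; rewrite subrr cabs0 => /(_ d0).
by rewrite (rootP hz0) subr0; lra.
Qed.

(** Induction by division: g = q (X - a) + g(a). The quotient is dominated by the remaining factors,
    and the constant by the whole product, each factor of which is at least d off the strip. *)
Lemma dominated_off_strip (d mu : R) (rs : seq C) g : 0 < d ->
  (forall a, a \in rs -> `|complex.Im a| <= mu - d) ->
  (size g <= (size rs).+1)%N ->
  exists2 M, 0 <= M & forall z, mu < `|complex.Im z| ->
    cabs g.[z] <= M * \prod_(a <- rs) cabs (z - a).
Proof.
move=> d0; elim: rs g => [|a rs IH] g hrs sg.
  exists (cabs g`_0); rewrite ?cabs_ge0// => z _; rewrite big_nil mulr1.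
  by rewrite (size1_polyC sg) hornerC coefC.
have far b z : b \in a :: rs -> mu < `|complex.Im z| -> d <= cabs (z - b).
  move=> /hrs hb hz; have := cabs_Im (z - b); rewrite cImD cImN.
  by have := ler_normB (complex.Im z - complex.Im b) (- complex.Im b);
    rewrite opprK subrK normrN; lra.
pose q := (g - g.[a]%:P) %/ ('X - a%:P).
have gE : g = q * ('X - a%:P) + g.[a]%:P.
  rewrite divpK ?subrK// dvdp_XsubCl rootE !hornerE subrr//.
have [M1 M10 hM1] : exists2 M, 0 <= M & forall z, mu < `|complex.Im z| ->
    cabs q.[z] <= M * \prod_(b <- rs) cabs (z - b).
  apply: IH => [b bin|]; first by rewrite hrs// in_cons bin orbT.
  rewrite size_divp ?polyXsubC_eq0// size_XsubC subn1 -subn1 leq_subLR add1n.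
  rewrite (leq_trans (size_polyD _ _))// geq_max sg size_polyN.
  by rewrite (leq_trans (size_polyC_leq1 _)).
have hp z : mu < `|complex.Im z| -> d ^+ size (a :: rs) <=
    \prod_(b <- a :: rs) cabs (z - b).
  move=> hz; have : {subset a :: rs <= a :: rs} by [].
  elim: {1 3 4}(a :: rs) => [|b s IHs] hs; first by rewrite big_nil expr0.
  rewrite big_cons exprS ler_pM//.
  - exact: ltW.
  - by rewrite exprn_ge0// ltW.
  - by rewrite far// hs// mem_head.
  - by apply: IHs => x xs; rewrite hs// in_cons xs orbT.
have dn0 : 0 < d ^+ size (a :: rs) by rewrite exprn_gt0.
exists (M1 + cabs g.[a] / d ^+ size (a :: rs)).
  by rewrite addr_ge0// divr_ge0 ?cabs_ge0// ltW.
move=> z hz; rewrite {1}gE !hornerE (le_trans (cabsD _ _))// mulrDl lerD//.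
  rewrite cabsM big_cons mulrC mulrCA ler_wpM2l ?cabs_ge0//; exact: hM1.
rewrite mulrAC -mulrA ler_peMr ?cabs_ge0// ler_pdivlMr// mul1r; exact: hp.
Qed.

(** Newton's identities for the first two power sums. *)
Lemma coef_prod_one_sub (xs : seq C) :
  let p := \prod_(x <- xs) (1 - x *: 'X) in
  [/\ p`_0 = 1, p`_1 = - \sum_(x <- xs) x &
      \sum_(x <- xs) x ^+ 2 = p`_1 ^+ 2 - 2 * p`_2].
Proof.
elim: xs => [|x xs /= [h0 h1 h2]] /=.
  by rewrite !big_nil !coefC/= oppr0 expr0n mulr0 subr0.
rewrite !big_cons h2; set p := \prod_(j <- _) _ in h0 h1 h2 *.
rewrite mulrBl mul1r -scalerAl !coefB !coefZ !coefXM /= h0 h1.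
by split; ring.
Qed.

Lemma sum_sqr_le_sqr_sum (I : eqType) (xs : seq I) (F : I -> R) :
  (forall x, x \in xs -> 0 <= F x) ->
  \sum_(x <- xs) F x ^+ 2 <= (\sum_(x <- xs) F x) ^+ 2.
Proof.
elim: xs => [|x xs IH] h; first by rewrite !big_nil expr0n.
rewrite !big_cons; have hx := h x (mem_head _ _).
have hs y : y \in xs -> 0 <= F y by move=> ys; rewrite h// in_cons ys orbT.
have := IH hs; have : 0 <= \sum_(j <- xs) F j.
  by rewrite big_seq sumr_ge0// => y /hs.
by set a := \sum_(j <- _) _; set b := \sum_(j <- _) _; nra.
Qed.

(* Writing p = p(0) prod (1 - x_j w) with all s Im x_j >= 0, the identity
   |x|^2 = Re x^2 + 2 (Im x)^2 bounds sum |x_j|^2 by the first two power sums;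
   then |1 - x w|^2 <= exp(- 2 Re(x w) + |x w|^2). *)
Lemma szasz p (s r : R) k : s ^+ 2 = 1 -> 0 <= r -> p`_0 != 0 ->
  (forall w, 0 < s * complex.Im w -> ~~ root p w) ->
  let E := cabs (p`_1 / p`_0) in
  let S := 3 * E ^+ 2 + 2 * cabs (p`_2 / p`_0) in
  cabs p`_k * r ^+ k <= cabs p`_0 * expR (E * r + S * r ^+ 2 / 2).
Proof.
move=> s1 r0 p00 hroot; cbv zeta; set E := cabs (p`_1 / p`_0).
set S := 3 * E ^+ 2 + 2 * cabs _.
have p0 : p != 0 by apply: contra p00 => /eqP ->; rewrite coef0.
have [rs Dp hrs] := normal_form p0; set c := lead_coef p in Dp.
have rsN0 a : a \in rs -> a != 0.
  by rewrite hrs; apply: contraTneq => ->; rewrite rootE horner_coef0.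
pose xs := [seq a^-1 | a <- rs].
pose P := \prod_(x <- xs) (1 - x *: 'X : {poly C}).
have pE : p = p`_0 *: P.
  have e : p = (c * \prod_(a <- rs) (- a)) *: P.
    rewrite {1}Dp -scalerA; congr (_ *: _).
    rewrite /P big_map -mul_polyC rmorph_prod /= -big_split /=.
    apply: eq_big_seq => a /rsN0 a0.
    by rewrite mulrBr mulr1 -mul_polyC mulrA -polyCM mulNr divff// polyCN; ring.
  have [P0 _ _] := coef_prod_one_sub xs; rewrite -/P in P0.
  by rewrite {2}e coefZ P0 mulr1 -e.
have [P0 P1 P2] := coef_prod_one_sub xs; rewrite -/P in P0 P1 P2.
have E1 : p`_1 / p`_0 = P`_1 by rewrite {1}pE coefZ mulrC mulKf.
have E2 : p`_2 / p`_0 = P`_2 by rewrite {1}pE coefZ mulrC mulKf.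
(* The zeros a satisfy s Im a <= 0, and inversion reverses the sign of the imaginary part. *)
have xsIm x : x \in xs -> 0 <= s * complex.Im x.
  move=> /mapP[a ain ->]; rewrite cImV mulrA mulrN mulNr oppr_ge0.
  rewrite mulr_le0_ge0 ?invr_ge0 ?sqr_ge0// leNgt; apply/negP => /hroot.
  by rewrite -hrs ain.
have hS : \sum_(x <- xs) cabs x ^+ 2 <= S.
  have -> : \sum_(x <- xs) cabs x ^+ 2 =
     complex.Re (\sum_(x <- xs) x ^+ 2) + 2 * \sum_(x <- xs) (s * complex.Im x) ^+ 2.
    rewrite cRe_sum mulr_sumr -big_split /=; apply: eq_bigr => x _.
    by rewrite exprMn s1 cabs_sqr [x ^+ 2]expr2 cReM; ring.
  have h1 := sum_sqr_le_sqr_sum xsIm.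
  have h2 : (\sum_(x <- xs) s * complex.Im x) ^+ 2 <= E ^+ 2.
    rewrite -mulr_sumr exprMn s1 mul1r -cIm_sum /E E1 P1 cabsN cabs_sqr.
    by rewrite lerDr sqr_ge0.
  have h3 : complex.Re (\sum_(x <- xs) x ^+ 2) <= E ^+ 2 + 2 * cabs (p`_2 / p`_0).
    apply: (le_trans (ler_norm _)); apply: (le_trans (cabs_Re _)).
    rewrite P2; apply: (le_trans (cabsB _ _)).
    by rewrite cabsX -E1 -/E E2 cabsM cabs_nat.
  by rewrite /S; lra.
apply: cauchy_estimate => // z hz.
rewrite {1}pE hornerZ cabsM ler_wpM2l ?cabs_ge0//.
rewrite -(ler_pXn2r (n := 2)) ?nnegrE ?cabs_ge0 ?expR_ge0//.
rewrite expr2 [X in _ <= X]expr2 -expRD horner_prod cabs_prod -expr2 -prodrXl.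
have h1 : \prod_(x <- xs) cabs (1 - x *: 'X).[z] ^+ 2 <=
   \prod_(x <- xs) expR (- 2 * complex.Re (x * z) + cabs (x * z) ^+ 2).
  apply: ler_prod => x _; rewrite sqr_ge0/= (le_trans _ (expR_ge1Dx _))//.
  rewrite !hornerE !cabs_sqr !cReD !cImD !cReN !cImN /=; lra.
apply: (le_trans h1); rewrite -expR_sum ler_expR big_split /=.
rewrite -mulr_sumr -cRe_sum -mulr_suml.
under [X in _ + X <= _]eq_bigr => x _ do rewrite cabsM exprMn hz.
rewrite -mulr_suml.
have h2 : - 2 * complex.Re ((\sum_(i <- xs) i) * z) <= 2 * (E * r).
  have := cabs_Re ((\sum_(i <- xs) i) * z).
  rewrite cabsM hz -(cabsN (\sum_(i <- _) _)) -P1 -E1 -/E.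
  by rewrite ler_norml; lra.
have h3 : (\sum_(i <- xs) cabs i ^+ 2) * r ^+ 2 <= S * r ^+ 2.
  by rewrite ler_wpM2r ?sqr_ge0.
lra.
Qed.

End PolyBounds.


(** * Compact convergence *)

Section Topology.
Variable R : realType.
Local Notation C := R[i].

Lemma cabs_ltE (z : C) (e : R) : (`|z| < e%:C%C) = (cabs z < e).
Proof. by rewrite normCE ltcR. Qed.

Lemma posC (e : C) : 0 < e -> exists2 r : R, 0 < r & e = r%:C%C.
Proof.
case: e => a b; rewrite ltcE /= => /andP[/eqP -> a0]; by exists a.
Qed.

Lemma cvg_cabsP (u : nat -> C^o) (l : C^o) :
  u @ \oo --> l <->
  forall e : R, 0 < e -> exists N, forall n, (N <= n)%N -> cabs (l - u n) < e.
Proof.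
split=> [/cvgrPdist_lt h e e0|h].
  have eC : 0 < e%:C%C :> C by rewrite ltcR.
  have [N _ hN] := h _ eC; exists N => n /hN /=.
  by rewrite -cabs_ltE.
apply/cvgrPdist_lt => _ /posC[e e0 ->].
by have [N hN] := h e e0; exists N => // n /= /hN; rewrite -cabs_ltE.
Qed.

Lemma cabs_continuous : continuous (fun z : C^o => cabs z : R^o).
Proof.
move=> z; apply/(@cvgrPdist_lt _ R^o _ (nbhs (z : C^o)) (nbhs_filter (z : C^o))) => e e0.
have eC : 0 < e%:C%C :> C by rewrite ltcR.
apply: filterS (nbhsx_ballx (z : C^o) _ eC) => w.
rewrite -ball_normE /= cabs_ltE.
have := cabs_lower z (- w); have := cabs_lower w (- z).
rewrite !cabsN (cabs_distC w z) => h1 h2 h3.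
by rewrite ltr_norml; lra.
Qed.

Lemma compact_cabs_bounded (A : set (C^o * C^o)) : compact A ->
  exists r : R, forall z w, A (z, w) -> cabs z <= r /\ cabs w <= r.
Proof.
move=> cA.
have bnd (f : C^o * C^o -> C^o) : continuous f ->
    exists r : R, forall x, A x -> cabs (f x) <= r.
  move=> cf.
  have : compact ((fun x => cabs (f x) : R^o) @` A).
    apply: continuous_compact => //; apply: continuous_subspaceT => x.
    by apply: (@continuous_comp _ _ _ f (fun z : C^o => cabs z : R^o));
      [exact: cf | exact: cabs_continuous].
  move=> /compact_bounded[M [_ hM]]; exists (M + 1) => x Ax.
  have := hM (M + 1); rewrite ltrDl ltr01 => /(_ isT (cabs (f x))) h.
  by rewrite (le_trans (ler_norm _))// h//; exists x.
have [r1 h1] := bnd _ (fun x => @cvg_fst _ _ _ _ _).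
have [r2 h2] := bnd _ (fun x => @cvg_snd _ _ _ _ _).
exists (Num.max r1 r2) => z w Azw; rewrite !le_max.
by rewrite (h1 _ Azw) (h2 _ Azw) orbT.
Qed.

(** Squares rather than discs, as they are continuous images of products of compact real
    segments. *)
Lemma square_compact (r : R) :
  compact [set z : C^o | `|complex.Re z| <= r /\ `|complex.Im z| <= r].
Proof.
have -> : [set z : C^o | `|complex.Re z| <= r /\ `|complex.Im z| <= r] =
    (fun x : R^o * R^o => (x.1 +i* x.2)%C : C^o) @`
      (`[- r, r]%classic `*` `[- r, r]%classic).
  apply/seteqP; split => [[a b] /= [ha hb]|_ [[a b] /= [ha hb] <-]] /=.
    by exists (a, b) => //=; rewrite !in_itv/= -!ler_norml.
  by move: ha hb; rewrite !in_itv/= -!ler_norml.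
apply: continuous_compact; last by apply: compact_setX; exact: segment_compact.
apply: continuous_subspaceT => -[a b]; apply/cvgrPdist_lt => _ /posC[e e0 ->].
have e20 : 0 < e / 2 by lra.
near=> x; rewrite cabs_ltE (le_lt_trans (cabs_ReIm _))// cReD cImD cReN cImN /=.
have h1 : `|a - x.1| < e / 2.
  near: x; apply: (@cvgr_dist_lt _ R^o _ _ _ (fun x : R^o * R^o => x.1) a) => //.
  exact: cvg_fst.
have h2 : `|b - x.2| < e / 2.
  near: x; apply: (@cvgr_dist_lt _ R^o _ _ _ (fun x : R^o * R^o => x.2) b) => //.
  exact: cvg_snd.
lra.
Unshelve. all: by end_near. Qed.

(** Every compact set lies in a bounded bidisc, and every bidisc in a compact product of squares. *)
Lemma family_compactP (F : nat -> C^o * C^o -> C^o) (f : C^o * C^o -> C^o) :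
  {family compact, F @ \oo --> f} <->
  forall r e : R, 0 < e -> exists N, forall n, (N <= n)%N -> forall z w : C,
    cabs z <= r -> cabs w <= r -> cabs (F n (z, w) - f (z, w)) < e.
Proof.
split=> [/fam_cvgP h r e e0|h].
  pose Q := [set z : C^o | `|complex.Re z| <= r /\ `|complex.Im z| <= r].
  have cQ : compact (Q `*` Q) by apply: compact_setX; exact: square_compact.
  have eC : 0 < e%:C%C :> C by rewrite ltcR.
  have /= := h _ cQ [set g | forall y, (Q `*` Q) y -> ball (f y) e%:C%C (g y)].
  move=> []; first apply/uniform_nbhs.
    exists [set xy | ball xy.1 e%:C%C xy.2]; split => //.
    exact: entourage_ball (PosNum eC).
  move=> N _ hN; exists N => n /hN /= hn z w hz hw.
  have := hn (z, w); rewrite -ball_normE /= cabs_ltE cabs_distC; apply.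
  by split; split; [apply: le_trans hz | apply: le_trans hz | apply: le_trans hw
    | apply: le_trans hw]; rewrite ?cabs_Re ?cabs_Im.
apply/fam_cvgP => A /compact_cabs_bounded[r hr] P /uniform_nbhs[E [entE sEP]].
move: entE; rewrite -entourage_ballE => -[/= _ /posC[e e0 ->] he].
have [N hN] := h r e e0; exists N => // n /= Nn; apply: sEP => -[z w] Azw.
have [hz hw] := hr z w Azw.
by apply: he; rewrite /= -ball_normE /= cabs_ltE cabs_distC; apply: hN.
Qed.

(** The intervals of radius 2K/2^n about the partial sums are nested; the supremum of their left
    ends lies in all of them. *)
Lemma real_geometric_limit (u : nat -> R) (K : R) :
  (forall k, `|u k| <= K / 2 ^+ k) ->
  exists S, forall n, `|S - \sum_(k < n) u k| <= 2 * K / 2 ^+ n.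
Proof.
move=> hu; pose s n := \sum_(k < n) u k; pose d n := 2 * K / 2 ^+ n.
have dS n : d n = K / 2 ^+ n + d n.+1.
  by rewrite /d exprS; field; rewrite expf_neq0// pnatr_eq0.
have K0 : 0 <= K by have := hu 0%N; rewrite expr0 divr1; apply: le_trans.
have d0 n : 0 <= d n by rewrite /d divr_ge0 ?mulr_ge0 ?exprn_ge0.
have up n m : s (n + m)%N <= s n + d n - d (n + m)%N /\
              s n - d n + d (n + m)%N <= s (n + m)%N.
  elim: m => [|m [IH1 IH2]]; first by rewrite addn0; lra.
  have -> : s (n + m.+1)%N = s (n + m)%N + u (n + m)%N.
    by rewrite addnS /s big_ord_recr.
  rewrite addnS; have := dS (n + m)%N; have := hu (n + m)%N; rewrite ler_norml.
  move: IH1 IH2; lra.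
have vw n m : s n - d n <= s m + d m.
  have [nm|nm] := leqP n m.
    have := (up n (m - n)%N).2; rewrite subnKC//; have := d0 m; lra.
  by have := (up m (n - m)%N).1; rewrite subnKC ?(ltnW nm)//; have := d0 n; lra.
pose V := [set s n - d n | n in setT].
have hV : has_sup V.
  split; first by exists (s 0%N - d 0%N), 0%N.
  by exists (s 0%N + d 0%N) => _ [n _ <-].
exists (sup V) => n; rewrite -/(s n) -/(d n) ler_norml.
have h1 : s n - d n <= sup V by apply: ub_le_sup; [exact: hV.2 | exists n].
have h2 : sup V <= s n + d n by apply: ge_sup; [exact: hV.1 | move=> _ [m _ <-]].
lra.
Qed.

Lemma geometric_limit (u : nat -> C) (K : R) :
  (forall k, cabs (u k) <= K / 2 ^+ k) ->
  exists S, forall n, cabs (S - \sum_(k < n) u k) <= 4 * K / 2 ^+ n.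
Proof.
move=> hu.
have [a ha] := @real_geometric_limit (fun k => complex.Re (u k)) K
  (fun k => le_trans (cabs_Re _) (hu k)).
have [b hb] := @real_geometric_limit (fun k => complex.Im (u k)) K
  (fun k => le_trans (cabs_Im _) (hu k)).
exists (a +i* b)%C => n; rewrite (le_trans (cabs_ReIm _))//.
rewrite cReD cImD cReN cImN cRe_sum cIm_sum /=.
have := ha n; have := hb n; lra.
Qed.

Lemma two_pow_small (K e : R) : 0 < e ->
  exists N, forall n, (N <= n)%N -> K / 2 ^+ n < e.
Proof.
move=> e0; have h0 : 0 <= `|K| / e by rewrite divr_ge0// ltW.
have := archi_boundP h0; set N := Num.bound _ => hN.
exists N => n Nn; rewrite ltr_pdivrMr ?exprn_gt0//.
rewrite (le_lt_trans (ler_norm _))// mulrC -ltr_pdivrMr// (lt_le_trans hN)//.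
by rewrite -natrX ler_nat (leq_trans Nn)// ltnW// ltn_expl.
Qed.

End Topology.


(** * The two sides of the strip *)

Section Paths.
Variable R : realType.
Local Notation C := R[i].
Implicit Types (z w a b : C) (p q f g h : {poly C}).

Lemma horner_map_Im p (t : R) :
  (map_poly (@complex.Im R) p).[t] = complex.Im p.[t%:C%C].
Proof.
rewrite (@horner_coef_wide _ (size p)) ?size_poly// horner_coef cIm_sum.
apply: eq_bigr => i _; rewrite coef_poly ltn_ord -rmorphXn cImM /=.
by rewrite mulr0 add0r.
Qed.

Lemma cIm_div z w : complex.Im (z / w) = complex.Im (z * conjc w) / cabs w ^+ 2.
Proof. by rewrite !cImM cReV cImV; case: w => c d /=; ring. Qed.

Lemma horner_conj p (t : R) :
  (map_poly (@conjc R) p).[t%:C%C] = conjc p.[t%:C%C].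
Proof. by rewrite -{1}(conjc_real t) horner_map. Qed.

(* Im (A conj B) is a real polynomial in t, so that the intermediate value
   theorem for polynomials applies. *)
Lemma Im_div_path (A B : {poly C}) (s : R) :
  (forall t : R, 0 <= t <= 1 -> B.[t%:C%C] != 0) ->
  (forall t : R, 0 <= t <= 1 -> complex.Im (A.[t%:C%C] / B.[t%:C%C]) != 0) ->
  0 < s * complex.Im (A.[0] / B.[0]) -> 0 < s * complex.Im (A.[1] / B.[1]).
Proof.
move=> hB hA h0; rewrite ltNge; apply/negP => h1.
pose q := s *: map_poly (@complex.Im R) (A * map_poly (@conjc R) B).
have qE t : q.[t] = s * complex.Im (A.[t%:C%C] * conjc B.[t%:C%C]).
  by rewrite hornerZ horner_map_Im hornerM horner_conj.
have qI t : 0 <= t <= 1 ->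
    q.[t] = s * complex.Im (A.[t%:C%C] / B.[t%:C%C]) * cabs B.[t%:C%C] ^+ 2.
  move=> /hB b0; rewrite qE cIm_div -mulrA divfK// expf_neq0//.
  by rewrite cabs_eq0.
have B0 := hB 0; have B1 := hB 1; have q0 := qI 0; have q1 := qI 1.
rewrite lexx ler01 /= ?rmorph0 ?rmorph1 in B0 B1 q0 q1.
have [t /andP[t0 t1]] : exists2 t, 0 <= t <= 1 & root (- q) t.
  apply: poly_ivt; first exact: ler01.
  rewrite !hornerN oppr_le0 oppr_ge0 q0// q1//; apply/andP; split.
    by rewrite mulr_ge0 ?sqr_ge0 ?ltW.
  by rewrite mulr_le0_ge0 ?sqr_ge0.
have ht : 0 <= t <= 1 by rewrite t0.
rewrite rootE hornerN oppr_eq0 qI// mulf_eq0 expf_eq0 /= cabs_eq0.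
rewrite (negPf (hB _ ht)) orbF mulf_eq0 (negPf (hA _ ht)) orbF => /eqP s0.
by move: h0; rewrite s0 mul0r ltxx.
Qed.

Lemma horner_segment (a b : C) (t : R) :
  ((1 - 'X) * a%:P + 'X * b%:P).[t%:C%C] = (1 - t)%:C%C * a + t%:C%C * b.
Proof. by rewrite !hornerE rmorphB rmorph1. Qed.

End Paths.

Definition prodX (K : nzRingType) (rs : seq K) : {poly K} :=
  \prod_(a <- rs) ('X - a%:P).

(** The sign [tau], which is 1 or -1, selects one of the two components of the complement of the
    closed strip, so that both are treated at once. *)
Definition half_plane (R : realType) (mu tau : R) : pred R[i] :=
  [pred z | mu < tau * complex.Im z].

Definition in_strip (R : realType) (mu : R) : pred R[i] :=
  [pred z | `|complex.Im z| < mu].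

Definition shift_ratio (R : realType) (T : {poly R[i]} -> {poly R[i]})
    (f : {poly R[i]}) (z : R[i]) : R[i] :=
  (T ('X * f)).[z] / (T f).[z].

Section Dichotomy.
Variables (R : realType) (T : {linear {poly R[i]} -> {poly R[i]}}).
Variables (mu tau : R) (N : nat).
Local Notation C := R[i].
Implicit Types (z w a b : C) (p q f g h : {poly C}) (rs l : seq C).
Hypothesis mu_gt0 : 0 < mu.
Hypothesis tau1 : tau ^+ 2 = 1.

Local Notation D := (half_plane mu tau).
Local Notation strip := (in_strip mu).
Local Notation rho := (shift_ratio T).

Hypothesis T_strip : forall rs z, all strip rs -> (N <= size rs)%N ->
  D z -> (T (prodX rs)).[z] != 0.

Let T_XsubC f a z : (T (('X - a%:P) * f)).[z] = (T ('X * f)).[z] - a * (T f).[z].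
Proof. by rewrite mulrBl mul_polyC linearB linearZ !hornerE. Qed.

Let T_rho f a z : (T f).[z] != 0 ->
  (T (('X - a%:P) * f)).[z] = (T f).[z] * (rho f z - a).
Proof. by move=> f0; rewrite T_XsubC /shift_ratio mulrBr mulrCA divff// mulr1 [a * _]mulrC. Qed.

(** A value of rho in the open strip could be taken as the zero a, and then T ((X - a) f) would
    vanish at z. *)
Let rho_gap f z : (T f).[z] != 0 ->
  (forall a, strip a -> (T (('X - a%:P) * f)).[z] != 0) ->
  mu <= `|complex.Im (rho f z)|.
Proof.
move=> f0 h; rewrite leNgt; apply/negP => /(h (rho f z)).
by rewrite T_rho// subrr mulr0 eqxx.
Qed.

Let good rs : all strip rs -> (N <= size rs)%N -> forall z, D z ->
  (T (prodX rs)).[z] != 0 /\ mu <= `|complex.Im (rho (prodX rs) z)|.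
Proof.
move=> hrs hN z hz; have h := T_strip hrs hN hz; split=> //.
apply: rho_gap => // a ha; have := @T_strip (a :: rs) z.
by rewrite /prodX big_cons /=; apply=> //; [apply/andP | apply: leq_trans hN _].
Qed.

Let gap_neq0 (x : R) : mu <= `|x| -> x != 0.
Proof. by apply: contraTneq => ->; rewrite normr0 -ltNge. Qed.

Let rho_path f a z (t : R) (g := (1 - t)%:C%C *: f + t%:C%C *: (('X - a%:P) * f)) :
  (T g).[z] = ((1 - 'X) * ((T f).[z])%:P + 'X * ((T (('X - a%:P) * f)).[z])%:P).[t%:C%C].
Proof.
by rewrite horner_segment /g linearD !linearZ !hornerE.
Qed.

(** Along the segment from f to (X - a) f, rho at z is a quotient of two polynomials in t, to which
    [Im_div_path] applies. *)
Let side_mul f a z (s : R) :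
  (forall t : R, 0 <= t <= 1 ->
     let g := (1 - t)%:C%C *: f + t%:C%C *: (('X - a%:P) * f) in
     (T g).[z] != 0 /\ mu <= `|complex.Im (rho g z)|) ->
  0 < s * complex.Im (rho f z) -> 0 < s * complex.Im (rho (('X - a%:P) * f) z).
Proof.
move=> h h0.
pose A := (1 - 'X) * ((T ('X * f)).[z])%:P
  + 'X * ((T ('X * (('X - a%:P) * f))).[z])%:P.
pose B := (1 - 'X) * ((T f).[z])%:P + 'X * ((T (('X - a%:P) * f)).[z])%:P.
have AE (t : R) : A.[t%:C%C] = (T ('X * ((1 - t)%:C%C *: f + t%:C%C *: (('X - a%:P) * f)))).[z].
  by rewrite /A horner_segment mulrDr -!scalerAr linearD !linearZ !hornerE.
have BE t : B.[t%:C%C] = (T ((1 - t)%:C%C *: f + t%:C%C *: (('X - a%:P) * f))).[z].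
  by rewrite -rho_path.
have A0 := AE 0; have A1 := AE 1; have B0 := BE 0; have B1 := BE 1.
rewrite !rmorph0 !subr0 scale0r addr0 rmorph1 scale1r in A0 B0.
rewrite !rmorph1 !subrr rmorph0 scale0r add0r scale1r in A1 B1.
have := @Im_div_path _ A B s; rewrite A0 A1 B0 B1.
by apply=> // t /h [h1 h2]; rewrite ?AE BE//; exact: gap_neq0 h2.
Qed.

(** On that segment the additional zero is a real translate of a, so it stays in the strip if a is
    there. *)
Let shift_root a (t : R) : 0 < t ->
  (1 - t)%:C%C *: 1 + t%:C%C *: ('X - a%:P) =
  t%:C%C *: ('X - (a - ((1 - t) / t)%:C%C)%:P) :> {poly C}.
Proof.
move=> t0; have e : (1 - t)%:C%C = t%:C%C * ((1 - t) / t)%:C%C :> C.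
  by rewrite -rmorphM mulrC divfK// gt_eqF.
by rewrite e -!mul_polyC polyCM polyCB; ring.
Qed.

Let side_strip_cons a rs z (s : R) : strip a -> all strip rs -> (N <= size rs)%N ->
  D z -> 0 < s * complex.Im (rho (prodX rs) z) <->
         0 < s * complex.Im (rho (prodX (a :: rs)) z).
Proof.
move=> ha hrs hN hz.
have h s' : 0 < s' * complex.Im (rho (prodX rs) z) ->
    0 < s' * complex.Im (rho (prodX (a :: rs)) z).
  rewrite /prodX big_cons; apply: side_mul => t /andP[t0 t1].
  set f := \prod_(_ <- _) _ => g.
  have -> : g = ((1 - t)%:C%C *: 1 + t%:C%C *: ('X - a%:P)) * f.
    by rewrite mulrDl -!scalerAl mul1r.
  have [->|tn0] := eqVneq t 0.
    by rewrite subr0 scale0r addr0 scale1r mul1r; exact: good.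
  have tp : 0 < t by rewrite lt_def tn0.
  rewrite shift_root//; set a' := a - _.
  have ha' : strip a' by rewrite /a' /in_strip /= cImD cImN /= oppr0 addr0.
  have hall : all strip (a' :: rs) by apply/andP.
  have [] := good hall (leq_trans hN (leqnSn _)) hz; rewrite /prodX big_cons.
  move=> h1 h2; have tC : t%:C%C != 0 :> C by rewrite (fmorph_eq0 (real_complex R)).
  rewrite /shift_ratio -scalerAl -scalerAr !linearZ !hornerZ.
  rewrite -mulf_div divff// mul1r; split => //; exact: mulf_neq0.
(* The converse is the direct implication for -s, since Im rho never vanishes. *)
split; first exact: h.
move=> h1; rewrite ltNge; apply/negP => h2.
have := h (- s); rewrite !mulNr !oppr_gt0 => h3.
have [_ /gap_neq0 n0] := good hrs hN hz.
move: h2; rewrite le_eqVlt mulf_eq0 (negPf n0) orbF => /orP[/eqP s0|h2].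
  by move: h1; rewrite s0 mul0r ltxx.
by have := h3 h2; lra.
Qed.

(** The half-plane is convex, so z and z' are joined by a segment inside it. *)
Let side_z rs z z' (s : R) : all strip rs -> (N <= size rs)%N -> D z -> D z' ->
  0 < s * complex.Im (rho (prodX rs) z) -> 0 < s * complex.Im (rho (prodX rs) z').
Proof.
move=> hrs hN hz hz'.
pose L : {poly C} := z%:P + (z' - z)%:P * 'X.
have := @Im_div_path _ (T ('X * prodX rs) \Po L) (T (prodX rs) \Po L) s.
have L0 : L.[0] = z by rewrite /L !hornerE.
have L1 : L.[1] = z' by rewrite /L !hornerE /=; ring.
rewrite !horner_comp L0 L1.
have LD (t : R) : 0 <= t <= 1 -> D L.[t%:C%C].
  move=> /andP[t0 t1]; have -> : L.[t%:C%C] = z + (z' - z) * t%:C%C.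
    by rewrite /L !hornerE.
  move: hz hz'; rewrite /half_plane /= !cImD cImM cImD cImN /= mulr0 add0r.
  move=> h1 h2.
  have -> : tau * (complex.Im z + (complex.Im z' - complex.Im z) * t) =
    (1 - t) * (tau * complex.Im z) + t * (tau * complex.Im z') by ring.
  have [->|tn0] := eqVneq t 1; first by lra.
  have t1' : 0 < 1 - t by rewrite subr_gt0 lt_def eq_sym tn0.
  nra.
by apply=> t /LD ht; have [h1 h2] := good hrs hN ht; rewrite horner_comp// horner_comp;
  apply: gap_neq0.
Qed.

(** The side is read off at one point for N zeros at the origin. It is carried to other points by
    [side_z], and to another list of zeros through the concatenation of both lists, which extends
    either one. *)
Lemma side_exists : exists2 s : R, s ^+ 2 = 1 &
  forall rs z, all strip rs -> (N <= size rs)%N -> D z ->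
    mu <= s * complex.Im (rho (prodX rs) z).
Proof.
pose z0 : C := (0 +i* (tau * (mu + 1)))%C.
have hz0 : D z0 by rewrite /half_plane /= mulrA -expr2 tau1; lra.
pose rs0 := nseq N (0 : C).
have hrs0 : all strip rs0 by rewrite all_nseq /in_strip inE raddf0 normr0 mu_gt0 orbT.
have [_ /gap_neq0 n0] := @good rs0 hrs0 (eq_leq (esym (size_nseq _ _))) z0 hz0.
have [s s1 hs] : exists2 s : R, s ^+ 2 = 1 & 0 < s * complex.Im (rho (prodX rs0) z0).
  have [h|h|h] := ltgtP (complex.Im (rho (prodX rs0) z0)) 0.
  - by exists (-1); rewrite ?sqrrN ?expr1n// mulN1r oppr_gt0.
  - by exists 1; rewrite ?expr1n// mul1r.
  - by rewrite h eqxx in n0.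
exists s => // rs z hrs hN hz.
have [_ gap] := good hrs hN hz.
have cat l rs1 : all strip l -> all strip rs1 -> (N <= size rs1)%N ->
    0 < s * complex.Im (rho (prodX rs1) z) <->
    0 < s * complex.Im (rho (prodX (l ++ rs1)) z).
  elim: l => [//|a l IH] /= /andP[ha hl] h1 hN1.
  apply: (iff_trans (IH hl h1 hN1)); apply: side_strip_cons => //.
    by rewrite all_cat hl.
  by rewrite size_cat (leq_trans hN1)// leq_addl.
have pos : 0 < s * complex.Im (rho (prodX rs) z).
  apply/(cat rs0 rs hrs0 hrs hN).
  have -> : prodX (rs0 ++ rs) = prodX (rs ++ rs0).
    by rewrite /prodX !big_cat /= mulrC.
  have sz0 : (N <= size rs0)%N by rewrite size_nseq.
  by apply/(cat _ _ hrs hrs0 sz0); exact: side_z hs.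
rewrite (le_trans gap)// -(gtr0_norm pos) normrM.
have -> : `|s| = 1 by apply/eqP; rewrite -sqr_norm_eq1 s1.
by rewrite mul1r.
Qed.

(* Zeros are added outside the strip one at a time: rho f lies on the side s, so
   it differs from a, and rho cannot cross the strip along the segment from f to
   ('X - a) f. *)
Lemma half_plane_nonvanishing (s : R) :
  (forall rs z, all strip rs -> (N <= size rs)%N -> D z ->
    mu <= s * complex.Im (rho (prodX rs) z)) ->
  s ^+ 2 = 1 ->
  forall l rs z, all [pred a : C | s * complex.Im a < mu] l -> all strip rs ->
    (N <= size rs)%N -> D z ->
    (T (prodX l * prodX rs)).[z] != 0 /\
    mu <= s * complex.Im (rho (prodX l * prodX rs) z).
Proof.
move=> hs s1; elim=> [|a l IH] rs z /=.
  move=> _ hrs hN hz; rewrite {1 3}/prodX big_nil mul1r.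
  by have [] := good hrs hN hz; split => //; exact: hs.
move=> /andP[ha hl] hrs hN hz.
(* The value is T f (z) times 1 - t + t (rho - a), whose imaginary part has the sign of s when t >
   0. *)
have step rs' (t : R) : all strip rs' -> (N <= size rs')%N -> 0 <= t <= 1 ->
    (T ((1 - t)%:C%C *: (prodX l * prodX rs')
      + t%:C%C *: (('X - a%:P) * (prodX l * prodX rs')))).[z] != 0.
  move=> hrs' hN' /andP[t0 t1]; have [f0 hf] := IH rs' z hl hrs' hN' hz.
  rewrite linearD hornerD !linearZ !hornerZ T_rho// mulrCA [X in X + _]mulrC -mulrDr mulf_neq0//.
  have [->|tn0] := eqVneq t 0; first by rewrite subr0 mul0r addr0 oner_eq0.
  apply/eqP => /(congr1 (@complex.Im R)); rewrite cImD cImM cImD cImN /=.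
  move=> e; have : 0 < t * (s * complex.Im (rho (prodX l * prodX rs') z) - s * complex.Im a).
    by rewrite mulr_gt0 ?lt_def ?tn0//; move: hf ha; lra.
  suff -> : t * (s * complex.Im (rho (prodX l * prodX rs') z) - s * complex.Im a) =
     s * (0 + (t * (complex.Im (rho (prodX l * prodX rs') z) - complex.Im a) +
      0 * complex.Re (rho (prodX l * prodX rs') z - a))).
    by rewrite e mulr0 ltxx.
  by rewrite mul0r addr0 add0r; ring.
have E : prodX (a :: l) * prodX rs = ('X - a%:P) * (prodX l * prodX rs).
  by rewrite /prodX big_cons mulrA.
have [f0 hf] := IH rs z hl hrs hN hz.
have h1 : (T (prodX (a :: l) * prodX rs)).[z] != 0.
  have := step rs 1 hrs hN; rewrite ler01 lexx subrr scale0r add0r scale1r E.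
  exact.
have gap (t : R) : 0 <= t <= 1 ->
  let g := (1 - t)%:C%C *: (prodX l * prodX rs)
            + t%:C%C *: (('X - a%:P) * (prodX l * prodX rs)) in
  (T g).[z] != 0 /\ mu <= `|complex.Im (rho g z)|.
  move=> ht g; have g0 : (T g).[z] != 0 by exact: step.
  split => //; apply: rho_gap => // b hb.
  (* A further zero b in the strip is absorbed into [rs]; this is why the induction on [l] keeps
     [rs] general. *)
  have -> : ('X - b%:P) * g = (1 - t)%:C%C *: (prodX l * prodX (b :: rs))
      + t%:C%C *: (('X - a%:P) * (prodX l * prodX (b :: rs))).
    by rewrite /g /prodX !big_cons -!mul_polyC; ring.
  apply: step => //; last exact: leq_trans hN (leqnSn _).
  by apply/andP.
split => //.
have pos : 0 < s * complex.Im (rho (prodX (a :: l) * prodX rs) z).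
  by rewrite E; apply: side_mul => //; exact: lt_le_trans hf.
have := gap 1; rewrite ler01 lexx subrr scale0r add0r scale1r -E => -[//|_ h].
rewrite (le_trans h)// -(gtr0_norm pos) normrM.
have -> : `|s| = 1 by apply/eqP; rewrite -sqr_norm_eq1 s1.
by rewrite mul1r.
Qed.

End Dichotomy.


(** * Entire symbols *)

Section Entire.
Variable R : realType.
Local Notation C := R[i].
Implicit Types (z w : C) (r q : R) (f g h : fps R).

(** Infinite radius of convergence in w, uniformly for z in each disc, expressed by bounds on the
    coefficients. *)
Definition entire_fps g := forall r q, 0 <= q ->
  exists K, forall k z, cabs z <= r -> cabs (g k).[z] * q ^+ k <= K.

Lemma entire_fps_bound g r q : entire_fps g -> 0 <= q ->
  exists2 K, 0 <= K & forall k z, cabs z <= r -> cabs (g k).[z] * q ^+ k <= K.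
Proof.
move=> hg q0; have [K hK] := hg r q q0; exists `|K| => // k z hz.
by rewrite (le_trans (hK k z hz))// ler_norm.
Qed.

Lemma entire_fps_exp (c : C) : entire_fps (fps_exp c).
Proof.
move=> r q q0; set x := cabs c * q; have x0 : 0 <= x by rewrite mulr_ge0 ?cabs_ge0.
exists (expR x) => k z _; rewrite hornerC cabsM cabsX cabsV cabs_nat mulrAC.
rewrite -exprMn -/x.
have nd : nondecreasing_seq (series (exp_coeff x)).
  apply/nondecreasing_seqP => n; rewrite /series /= big_nat_recr//= lerDl.
  exact: exp_coeff_ge0.
have := nondecreasing_cvgn_le nd (is_cvg_series_exp_coeff x) k.+1.
apply: le_trans; rewrite /series /= big_nat_recr//= lerDr.
by apply: sumr_ge0 => i _; exact: exp_coeff_ge0.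
Qed.

(** With the bounds taken at radius 2q, the k + 1 terms of a coefficient are absorbed by 2^k >= k +
    1. *)
Lemma entire_fps_mul f g : entire_fps f -> entire_fps g -> entire_fps (fps_mul f g).
Proof.
move=> hf hg r q q0; have q20 : 0 <= 2 * q by rewrite mulr_ge0.
have [Kf Kf0 hKf] := entire_fps_bound r hf q20.
have [Kg Kg0 hKg] := entire_fps_bound r hg q20.
exists (Kf * Kg) => k z hz; rewrite /fps_mul horner_sum.
rewrite -(ler_pM2l (x := 2 ^+ k)) ?exprn_gt0// mulrCA -exprMn.
apply: (@le_trans _ _ (\sum_(i < k.+1) Kf * Kg)); last first.
  rewrite sumr_const card_ord -[leLHS]mulr_natl ler_wpM2r ?mulr_ge0//.
  by rewrite -natrX ler_nat ltn_expl.
apply: (@le_trans _ _ ((\sum_(i < k.+1) cabs (f i * g (k - i)%N).[z]) * (2 * q) ^+ k)).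
  by rewrite ler_wpM2r ?exprn_ge0// cabs_sum.
rewrite mulr_suml; apply: ler_sum => i _; rewrite hornerM cabsM.
have ik : (i <= k)%N by rewrite -ltnS.
have -> : (2 * q) ^+ k = (2 * q) ^+ i * (2 * q) ^+ (k - i) by rewrite -exprD subnKC.
rewrite mulrACA ler_pM ?mulr_ge0 ?cabs_ge0 ?exprn_ge0//.
  exact: hKf.
exact: hKg.
Qed.

(** The operator -d/dw inserts a factor x under T in T(e^(-xw)). The radius 2q + 1 absorbs the
    factor k + 1, and being at least 1 it also allows the exponent to be raised by one. *)
Lemma entire_fps_deriv g : entire_fps g -> entire_fps (fun k => - (k.+1%:R *: g k.+1)).
Proof.
move=> hg r q q0; have q20 : 0 <= 2 * q + 1 by lra.
have [K K0 hK] := entire_fps_bound r hg q20.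
exists K => k z hz; rewrite hornerN cabsN hornerZ cabsM cabs_nat.
apply: le_trans (hK k.+1 z hz); rewrite mulrAC mulrC ler_wpM2l ?cabs_ge0//.
apply: (@le_trans _ _ ((2 * q) ^+ k)).
  by rewrite exprMn ler_wpM2r ?exprn_ge0// -natrX ler_nat ltn_expl.
rewrite exprS; apply: (@le_trans _ _ ((2 * q + 1) ^+ k)).
  by apply: lerXn2r; rewrite ?nnegrE//; lra.
by rewrite ler_peMl ?exprn_ge0//; lra.
Qed.

Lemma entire_fps_ext f g : f =1 g -> entire_fps f -> entire_fps g.
Proof.
by move=> e hf r q q0; have [K hK] := hf r q q0; exists K => k z; rewrite -e; exact: hK.
Qed.

Lemma entire_fps_tail g N : entire_fps (fun k => g (k + N)%N) -> entire_fps g.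
Proof.
move=> hg r q q0; have [K K0 hK] := entire_fps_bound r hg q0.
have [M hM] : exists M, forall k z, (k < N)%N -> cabs z <= r ->
    cabs (g k).[z] * q ^+ k <= M.
  elim: (N) => [|n [M hM]]; first by exists 0.
  have [ub hub] := poly_disk_bound (g n) r%:C%C.
  exists (Num.max M (complex.Re ub * q ^+ n)) => k z; rewrite ltnS leq_eqVlt.
  case/orP => [/eqP -> hz|kn hz]; last by rewrite le_max hM.
  rewrite le_max ler_wpM2r ?exprn_ge0 ?orbT//.
  have : `|z| <= r%:C%C by rewrite normCE lecR.
  by move/hub; rewrite normCE lecE => /andP[].
exists (Num.max M (K * q ^+ N)) => k z hz; rewrite le_max.
have [kN|Nk] := ltnP k N; first by rewrite hM.
rewrite -(subnK Nk) exprD mulrA ler_wpM2r ?exprn_ge0 ?orbT//; exact: hK.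
Qed.

End Entire.

(** * From (1 - x/n)^n to the exponential *)

Section Binomial.
Variable R : realType.
Local Notation C := R[i].

(** The ratio of the k-th coefficients of (1 - x/n)^n and e^(-x). *)
Definition fall_ratio (n k : nat) : R := (n ^_ k)%:R / n%:R ^+ k.

Lemma fall_ratio_bounds n k : (0 < n)%N ->
  0 <= fall_ratio n k <= 1 /\ 1 - k%:R ^+ 2 / n%:R <= fall_ratio n k.
Proof.
move=> n0; have nR : 0 < n%:R :> R by rewrite ltr0n.
elim: k => [|k [/andP[IH0 IH1] IH2]].
  by rewrite /fall_ratio ffactn0 expr0 divr1 lexx ler01 expr0n/= mul0r subr0.
have e : fall_ratio n k.+1 = fall_ratio n k * ((n - k)%N%:R / n%:R).
  by rewrite /fall_ratio ffactnSr natrM exprSr invfM mulrACA.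
have t0 : 0 <= (n - k)%N%:R / n%:R :> R by rewrite divr_ge0.
have t1 : (n - k)%N%:R / n%:R <= 1 :> R.
  by rewrite ler_pdivrMr// mul1r ler_nat leq_subr.
have t2 : 1 - k%:R / n%:R <= (n - k)%N%:R / n%:R :> R.
  rewrite lerBlDr -mulrDl ler_pdivlMr// mul1r -natrD ler_nat; lia.
rewrite e; split; first by rewrite mulr_ge0//= mulr_ile1.
have k0 : 0 <= k%:R / n%:R :> R by rewrite divr_ge0.
have s : k.+1%:R ^+ 2 / n%:R = k%:R ^+ 2 / n%:R + 2 * (k%:R / n%:R) + n%:R^-1 :> R.
  by rewrite -natr1; field; rewrite gt_eqF.
have i0 : 0 <= n%:R^-1 :> R by rewrite invr_ge0.
rewrite s; set x := fall_ratio n k in IH0 IH1 IH2 *.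
set y := _ / _ in t0 t1 t2 *; set v := k%:R / n%:R in k0 t2 *.
nra.
Qed.

Lemma bin_fall n k : (0 < n)%N ->
  'C(n, k)%:R * (- n%:R^-1) ^+ k =
  (fall_ratio n k)%:C%C * ((-1) ^+ k / k`!%:R) :> C.
Proof.
move=> n0; rewrite /fall_ratio -bin_ffact natrM.
rewrite rmorphM fmorphV rmorphXn rmorphM !rmorph_nat.
rewrite -[- n%:R^-1]mulN1r exprMn exprVn.
field; rewrite expf_neq0 ?pnatr_eq0 -?lt0n// ?fact_gt0// pnatr_eq0 -lt0n.
Qed.

End Binomial.


(** * Rational functions between half-planes *)

Section Degree.
Variable R : realType.
Local Notation C := R[i].
Implicit Types (z w u v : C) (p A B : {poly C}).

Lemma root_in_half_plane d u (tau : R) : (1 < d)%N -> tau ^+ 2 = 1 ->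
  complex.Im u != 0 -> exists2 w, w ^+ d = u & 0 < tau * complex.Im w.
Proof.
move=> d1 tau1 u0; have d0 : (0 < d)%N by exact: ltnW.
have upper v : complex.Im v != 0 -> exists2 w, w ^+ d = v & 0 < complex.Im w.
  move=> v0; exists (d.-root v); first exact: rootCK.
  rewrite lt_def; apply/andP; split; last first.
    by have := Im_rootC_ge0 v d1; rewrite -complexIm ler0c.
  apply: contra v0 => /eqP h; rewrite -(rootCK d0 v) [d.-root v]complex_eta h.
  by rewrite (_ : (0 +i* 0)%C = 0)// addr0 -rmorphXn.
have /eqP := tau1; rewrite sqrf_eq1 => /orP[/eqP ->|/eqP ->].
  by have [w w1 w2] := upper u u0; exists w; rewrite ?mul1r.
have [|w w1 w2] := upper (conjc u); first by case: (u) u0 => a b /=; rewrite oppr_eq0.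
exists (conjc w); first by rewrite -rmorphXn w1 /= conjcK.
by case: (w) w2 => a b /=; rewrite mulN1r opprK.
Qed.

(** Take v = -is, or v = 1 - is when g is purely imaginary. *)
Lemma nonreal_direction (g : C) (s : R) : s ^+ 2 = 1 -> g != 0 ->
  exists2 v, s * complex.Im v < 0 & complex.Im (v * g) != 0.
Proof.
move=> s1 g0; have sv (k : R) : s * complex.Im (k +i* - s)%C < 0.
  by rewrite /= mulrN -expr2 s1 ltrN10.
have s0 : s != 0 by apply: contra_eq_neq s1 => ->; rewrite expr0n eq_sym oner_eq0.
have [g1|g1] := eqVneq (complex.Re g) 0.
  exists (1 +i* - s)%C => //; rewrite cImM /= g1 mulr0 addr0 mul1r.
  by apply: contra g0; case: (g) g1 => a b /= -> /eqP ->.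
exists (0 +i* - s)%C => //.
by rewrite cImM /= mul0r add0r mulf_neq0// oppr_eq0.
Qed.

(* A rational function mapping a half-plane into a half-plane grows at most
   linearly: otherwise its leading term takes values in the wrong half-plane
   along some ray. *)
Lemma size_half_plane_ratio A B (mu tau s : R) : tau ^+ 2 = 1 -> s ^+ 2 = 1 ->
  (forall z, half_plane mu tau z -> 0 < s * complex.Im (A.[z] / B.[z])) ->
  (size A <= (size B).+1)%N.
Proof.
move=> tau1 s1 hpos; rewrite leqNgt; apply/negP => sAB.
have A0 : A != 0 by rewrite -size_poly_gt0 (leq_trans _ sAB).
have B0 : B != 0.
  apply/eqP => B0; have := hpos (0 +i* (tau * (mu + 1)))%C.
  rewrite /half_plane /= mulrA -expr2 tau1 B0 horner0 invr0 mulr0 mulr0 ltxx.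
  by move=> h; apply: notF; apply: h; rewrite mul1r ltrDl.
set al := lead_coef A; set be := lead_coef B.
have al0 : al != 0 by rewrite lead_coef_eq0.
have be0 : be != 0 by rewrite lead_coef_eq0.
pose d := ((size A).-1 - (size B).-1)%N.
have sB : (0 < size B)%N by rewrite size_poly_gt0.
have sBA : ((size B).-1 <= (size A).-1)%N by lia.
have d1 : (1 < d)%N by rewrite /d; lia.
(* The direction v points to the wrong side. With w^d = v be / al, the leading term of A/B along the
   ray t w is t^d v; as d >= 2, such a w exists in the prescribed half-plane. *)
have [v sv vg] := nonreal_direction s1 (mulf_neq0 be0 (invr_neq0 al0)).
have [w wd w0] := root_in_half_plane d1 tau1 vg.
have wn0 : w != 0 by apply: contraTneq w0 => ->; rewrite /= mulr0 ltxx.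
pose L := (w%:P * 'X : {poly C}).
have sL : size L = 2%N by rewrite /L size_Cmul// size_polyX.
have lL : lead_coef L = w by rewrite /L lead_coefM lead_coefC lead_coefX mulr1.
pose M := (A \Po L) * map_poly (@conjc R) (B \Po L).
have lM : lead_coef M = al * w ^+ (size A).-1 * conjc (be * w ^+ (size B).-1).
  have lcomp (p : {poly C}) : lead_coef (p \Po L) = lead_coef p * w ^+ (size p).-1.
    by rewrite lead_coef_comp; [rewrite lL | rewrite sL].
  by rewrite lead_coefM lead_coef_map lcomp lcomp.
have Im_lM : s * complex.Im (lead_coef M) < 0.
  have z0 : be * w ^+ (size B).-1 != 0 by rewrite mulf_neq0// expf_neq0.
  have := cIm_div (al * w ^+ (size A).-1) (be * w ^+ (size B).-1).
  have -> : al * w ^+ (size A).-1 / (be * w ^+ (size B).-1) = v.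
    have -> : w ^+ (size A).-1 = v * (be / al) * w ^+ (size B).-1.
      by rewrite -wd -exprD /d subnK.
     field; rewrite expf_neq0//=; exact/andP.
  rewrite lM => e; move: sv. rewrite e mulrA ltr_pdivrMr ?mul0r//.
  by rewrite exprn_gt0// cabs_gt0.
(* A real polynomial in t with positive leading coefficient, hence positive for large t, which puts
   A/B on the wrong side. *)
pose Q := - (s *: map_poly (@complex.Im R) M).
have QE t : Q.[t] = - (s * complex.Im (A.[w * t%:C%C] * conjc B.[w * t%:C%C])).
  rewrite /Q hornerN hornerZ horner_map_Im /M hornerM horner_conj !horner_comp.
  by rewrite /L !hornerE.
have M0 : M != 0.
  by apply: contraTneq Im_lM => ->; rewrite lead_coef0 /= mulr0 ltxx.
have Qc : Q`_(size M).-1 = - (s * complex.Im (lead_coef M)).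
  by rewrite /Q coefN coefZ coef_map_id0.
have lQ : lead_coef Q = - (s * complex.Im (lead_coef M)).
  rewrite -Qc lead_coefE; congr (_`_ _); apply/eqP; rewrite eqn_leq; apply/andP.
  have sM : (0 < size M)%N by rewrite size_poly_gt0.
  split.
    rewrite -!subn1 leq_sub2r// /Q size_polyN (leq_trans (size_scale_leq _ _))//.
    exact: size_poly.
  have : ((size M).-1 < size Q)%N.
    rewrite ltnNge; apply/negP => /leq_sizeP /(_ _ (leqnn _)); rewrite Qc.
    by move: Im_lM => /[swap] /eqP; rewrite oppr_eq0 => /eqP ->; rewrite ltxx.
  by case: (size Q) => // n; rewrite ltnS.
have [|n hn] := @poly_pinfty_gt_lc _ Q; first by rewrite lQ oppr_gt0.
pose t := Num.max n (`|mu| / (tau * complex.Im w) + 1).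
have tn : n <= t by rewrite /t le_max lexx.
have ht : half_plane mu tau (w * t%:C%C).
  rewrite /half_plane /= cImM /= mulr0 add0r mulrA mulrC.
  rewrite -ltr_pdivrMr// /t lt_max; apply/orP; right.
  by rewrite ltr_pwDr// ler_pM2r ?invr_gt0// ler_norm.
have := hn t tn; rewrite lQ QE; have := hpos _ ht; rewrite cIm_div mulrA.
(* At a zero of B the quotient is 0 by convention, which the strict inequality excludes. *)
have [->|Bt] := eqVneq B.[w * t%:C%C] 0.
  by rewrite cabs0 expr0n invr0 mulr0 ltxx.
rewrite pmulr_lgt0 ?invr_gt0 ?exprn_gt0 ?cabs_gt0//; move: Im_lM; lra.
Qed.

(** Cauchy's estimate bounds the Taylor coefficients at z0; enlarging the radius costs L^n, and the
    number n of terms is at most 2^n. *)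
Lemma disc_extension p z0 (d L K : R) n : 0 < d -> 1 <= L -> (size p <= n)%N ->
  (forall z, cabs (z - z0) <= d -> cabs p.[z] <= K) ->
  forall z, cabs (z - z0) <= L * d -> cabs p.[z] <= K * (2 * L) ^+ n.
Proof.
move=> d0 L1 sp hp z hz.
have K0 : 0 <= K.
  by have := hp z0; rewrite subrr cabs0 => /(_ (ltW d0)); apply: le_trans; exact: cabs_ge0.
pose q := p \Po ('X + z0%:P).
have qE u : q.[u] = p.[u + z0] by rewrite horner_comp !hornerE.
have hq i : cabs q`_i * d ^+ i <= K.
  apply: cauchy_estimate => [|u hu]; first exact: ltW.
  by rewrite qE hp// addrK hu.
have -> : p.[z] = q.[z - z0] by rewrite qE subrK.
rewrite (@horner_coef_wide _ n); last first.
  by rewrite size_comp_poly2// size_XaddC.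
rewrite (le_trans (cabs_sum _ _ _))//.
apply: (@le_trans _ _ (\sum_(i < n) K * L ^+ n)).
  apply: ler_sum => i _; rewrite cabsM cabsX.
  apply: (@le_trans _ _ (cabs q`_i * (L * d) ^+ i)).
    by rewrite ler_wpM2l ?cabs_ge0// lerXn2r ?nnegrE ?cabs_ge0// mulr_ge0; lra.
  rewrite exprMn mulrCA mulrC ler_pM ?mulr_ge0 ?cabs_ge0 ?exprn_ge0 ?hq//; try lra.
  by rewrite ler_weXn2l// ltnW.
rewrite sumr_const card_ord -[leLHS]mulr_natl exprMn [leRHS]mulrCA ler_wpM2r//.
  by rewrite mulr_ge0// exprn_ge0; lra.
by rewrite -natrX ler_nat ltnW// ltn_expl.
Qed.

End Degree.


(** * The symbol is entire *)

Section Growth.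
Variables (R : realType) (T : {linear {poly R[i]} -> {poly R[i]}}).
Variables (mu tau s : R) (N : nat).
Local Notation C := R[i].
Local Notation D := (half_plane mu tau).
Local Notation strip := (in_strip mu).
Implicit Types (z w a b : C) (p q f g h y : {poly C}) (rs l : seq C).
Hypothesis mu_gt0 : 0 < mu.
Hypothesis tau1 : tau ^+ 2 = 1.
Hypothesis s1 : s ^+ 2 = 1.
Hypothesis T_strip : forall rs z, all strip rs -> (N <= size rs)%N ->
  D z -> (T (prodX rs)).[z] != 0.
Hypothesis T_side : forall rs z, all strip rs -> (N <= size rs)%N -> D z ->
  mu <= s * complex.Im (shift_ratio T (prodX rs) z).

Lemma poly_bounded p (r : R) :
  exists M, forall z, cabs z <= r -> cabs p.[z] <= M.
Proof.
have [ub hub] := poly_disk_bound p r%:C%C; exists (complex.Re ub) => z hz.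
have : `|z| <= r%:C%C by rewrite normCE lecR.
by move/hub; rewrite normCE lecE => /andP[].
Qed.

Lemma prodX_nseq (n : nat) (a : C) : prodX (nseq n a) = ('X - a%:P) ^+ n.
Proof. by rewrite /prodX big_nseq; elim: n => //= n ->; rewrite exprS. Qed.

Lemma strip_nseq (n : nat) (x : R) : all strip (nseq n x%:C%C).
Proof. by rewrite all_nseq /in_strip /= normr0 mu_gt0 orbT. Qed.

Lemma linear_binomial (n : nat) (c : C) y h z :
  (T ((1 - c *: y) ^+ n * h)).[z] =
  \sum_(i < n.+1) 'C(n, i)%:R * (- c) ^+ i * (T (y ^+ i * h)).[z].
Proof.
rewrite exprDn mulr_suml linear_sum horner_sum; apply: eq_bigr => i _.
rewrite expr1n mul1r -scaleNr exprZn -scaler_nat scalerA -scalerAl linearZ.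
by rewrite hornerZ.
Qed.

(** The zero of 1 - (w/n)(X - b) is b + n/w, and s Im (n/w) < 0, so that [half_plane_nonvanishing]
    applies. *)
Lemma half_plane_binomial (n : nat) b w z rs : (0 < n)%N ->
  s * complex.Im b <= mu -> 0 < s * complex.Im w -> all strip rs ->
  (N <= size rs)%N -> D z ->
  (T ((1 - (w / n%:R) *: ('X - b%:P)) ^+ n * prodX rs)).[z] != 0.
Proof.
move=> n0 hb hw hrs hN hz.
have w0 : w != 0 by apply: contraTneq hw => ->; rewrite /= mulr0 ltxx.
have nC : n%:R != 0 :> C by rewrite pnatr_eq0 -lt0n.
have -> : 1 - (w / n%:R) *: ('X - b%:P) =
    (- (w / n%:R)) *: ('X - (b + n%:R / w)%:P).
  have e : (w / n%:R)%:P * (n%:R / w)%:P = 1 :> {poly C}.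
    by rewrite -polyCM (_ : _ * _ = 1) ?polyC1//; field; rewrite w0 nC.
  by rewrite -!mul_polyC polyCN polyCD -{1}e; ring.
rewrite exprZn -scalerAl linearZ hornerZ mulf_neq0//.
  by rewrite expf_neq0// oppr_eq0 mulf_neq0// invr_neq0.
rewrite -prodX_nseq.
apply: (half_plane_nonvanishing mu_gt0 T_strip T_side s1 _ hrs hN hz).1.
rewrite all_nseq; apply/orP; right; rewrite /= cImD mulrDr.
have -> : complex.Im (n%:R / w) = n%:R * (- complex.Im w / cabs w ^+ 2).
  by rewrite cImM cImV -(rmorph_nat (real_complex R)) /= mul0r addr0.
suff : s * (n%:R * (- complex.Im w / cabs w ^+ 2)) < 0 by lra.
rewrite mulrCA pmulr_rlt0 ?ltr0n// mulrA mulrN mulNr oppr_lt0.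
by rewrite divr_gt0// exprn_gt0// cabs_gt0.
Qed.

Let z0 : C := (0 +i* (tau * (mu + 1)))%C.

Let ball_D z : cabs (z - z0) < 1 -> D z.
Proof.
move=> h; have := cabs_Im (z - z0); rewrite cImD cImN /= => h1.
have h2 : `|complex.Im z - tau * (mu + 1)| < 1 by exact: le_lt_trans h1 h.
have e : tau * (complex.Im z - tau * (mu + 1)) = tau * complex.Im z - (mu + 1).
  by rewrite mulrBr mulrA -expr2 tau1 mul1r.
have t1 : `|tau| = 1 by apply/eqP; rewrite -sqr_norm_eq1 tau1.
have : `|tau * (complex.Im z - tau * (mu + 1))| < 1 by rewrite normrM t1 mul1r.
by rewrite e ltr_norml /half_plane /=; lra.
Qed.

Let TXn_neq0 k z : D z -> (T 'X^(k + N)).[z] != 0.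
Proof.
move=> hz; have := T_strip (strip_nseq (k + N) 0) _ hz; rewrite size_nseq leq_addl.
by rewrite prodX_nseq subr0; apply.
Qed.

(** Szasz's inequality is applied in w to T((1 - xw/n)^n x^N) at fixed z. A lower bound for T x^N
    and upper bounds for T x^N, T x^(N+1) and T x^(N+2) near [z0] make it uniform in z and n. *)
Let szasz_bound (r : R) : 0 <= r -> exists K, forall k z, cabs (z - z0) <= 1 / 2 ->
  cabs (T 'X^(k + N)).[z] / k`!%:R * r ^+ k <= K.
Proof.
move=> r0.
have [m m0 hm] := @poly_lower_bound _ (T 'X^N) z0 1 ltr01
  (fun z hz => TXn_neq0 0 (ball_D hz)).
have bnd k : exists M, forall z, cabs (z - z0) <= 1 / 2 -> cabs (T 'X^(k + N)).[z] <= M.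
  have [M hM] := poly_bounded (T 'X^(k + N)) (cabs z0 + 1 / 2).
  exists M => z hz; apply: hM; have := cabsD (z - z0) z0; rewrite subrK.
  by move: hz; lra.
have [M0 hM0] := bnd 0%N; have [M1 hM1] := bnd 1%N; have [M2 hM2] := bnd 2%N.
pose E0 := M1 / m; pose S0 := 3 * E0 ^+ 2 + 2 * (M2 / m).
exists (2 * (M0 * expR (E0 * r + S0 * r ^+ 2 / 2))) => k z hz.
have hzD : D z by apply: ball_D; apply: le_lt_trans hz _; lra.
(* From n >= 2k^2 it follows that [fall_ratio] is at least 1/2, so the k-th coefficient loses at
   most a factor 2. *)
pose n := (2 * k ^ 2).+2.
have n_ge : (2 * k ^ 2 <= n)%N by do 2!apply: leqW.
pose phi := \poly_(i < n.+1)
  ('C(n, i)%:R * (- n%:R^-1) ^+ i * (T 'X^(i + N)).[z]).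
have phiC i : phi`_i = (fall_ratio R n i)%:C%C * ((-1) ^+ i / i`!%:R)
     * (T 'X^(i + N)).[z].
  rewrite coef_poly -bin_fall//; case: ltnP => // hi.
  by rewrite bin_small// !mul0r.
have phi_abs i : cabs phi`_i = fall_ratio R n i * (cabs (T 'X^(i + N)).[z] / i`!%:R).
  have [/andP[f0 _] _] := fall_ratio_bounds R i (isT : (0 < n)%N).
  rewrite phiC !cabsM cabs_real (ger0_norm f0) cabsX cabsN cabs1 expr1n mul1r.
  by rewrite cabsV cabs_nat; ring.
have phi_le i : cabs phi`_i <= cabs (T 'X^(i + N)).[z].
  have [/andP[f0 f1] _] := fall_ratio_bounds R i (isT : (0 < n)%N).
  rewrite phi_abs -[leRHS]mul1r ler_pM ?divr_ge0 ?cabs_ge0//.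
  by rewrite ler_piMr ?cabs_ge0// invf_le1 ?ltr0n ?fact_gt0// ler1n fact_gt0.
have phi0 : phi`_0 = (T 'X^N).[z].
  by rewrite phiC /fall_ratio ffactn0 !expr0 fact0 !divr1 rmorph1 !mul1r.
have phi0_ge : m <= cabs phi`_0 by rewrite phi0 hm.
have phi00 : phi`_0 != 0 by rewrite -cabs_gt0 (lt_le_trans m0).
have phi_root w : 0 < s * complex.Im w -> ~~ root phi w.
  move=> hw; rewrite rootE /phi horner_poly.
  have := @half_plane_binomial n 0 w z (nseq N 0) isT _ hw (strip_nseq N 0).
  rewrite size_nseq leqnn mulr0 (ltW mu_gt0) prodX_nseq subr0 => /(_ isT isT hzD).
  rewrite linear_binomial; congr (~~ (_ == 0)); apply: eq_bigr => i _.
  by rewrite -exprD -mulrN exprMn; ring.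
have ratio_le i M : cabs (T 'X^(i + N)).[z] <= M -> cabs (phi`_i / phi`_0) <= M / m.
  move=> hM; rewrite cabsM cabsV ler_pM ?invr_ge0 ?cabs_ge0//.
    exact: le_trans (phi_le i) hM.
  by rewrite lef_pV2 ?posrE// (lt_le_trans m0).
have sz := szasz k s1 r0 phi00 phi_root; cbv zeta in sz.
have hE := ratio_le _ _ (hM1 z hz); have hS := ratio_le _ _ (hM2 z hz).
have hb : cabs phi`_k * r ^+ k <= M0 * expR (E0 * r + S0 * r ^+ 2 / 2).
  apply: (le_trans sz); rewrite ler_pM ?cabs_ge0 ?expR_ge0//.
    by rewrite phi0 hM0.
  rewrite ler_expR lerD// ?ler_wpM2r ?sqr_ge0// ?invr_ge0// /S0 lerD//.
    rewrite ler_wpM2l// lerXn2r// ?nnegrE ?cabs_ge0//.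
    exact: le_trans (cabs_ge0 _) hE.
  by rewrite ler_wpM2l.
have [_ f2] := fall_ratio_bounds R k (isT : (0 < n)%N).
have f3 : 1 / 2 <= fall_ratio R n k.
  apply: le_trans f2; rewrite lerBrDr -lerBrDl ler_pdivrMr ?ltr0n//.
  have : 2 * k%:R ^+ 2 <= n%:R :> R by rewrite -natrX -natrM ler_nat.
  lra.
move: hb; rewrite phi_abs -mulrA.
set x := cabs _ / _ * _; set y := M0 * _ => hb.
have x0 : 0 <= x by rewrite /x mulr_ge0 ?divr_ge0 ?cabs_ge0 ?exprn_ge0.
nra.
Qed.

Let size_TXn k : (size (T 'X^(k + N)) <= size (T 'X^N) + k)%N.
Proof.
elim: k => [|k IH]; first by rewrite addn0.
rewrite addnS (leq_trans _ (_ : (size (T 'X^(k + N))).+1 <= _)%N)//.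
apply: (size_half_plane_ratio (mu := mu) tau1 s1) => z hz.
have := T_side (strip_nseq (k + N) 0) _ hz; rewrite size_nseq leq_addl => /(_ isT).
rewrite prodX_nseq subr0 /shift_ratio -exprS -addSn.
by apply: lt_le_trans.
Qed.

Lemma entire_symbol : entire_fps (symbol T).
Proof.
apply: (entire_fps_tail (N := N)) => r q q0.
(* The disc of radius L/2 about [z0] contains |z| <= r. Extending to it costs (2L)^k up to a
   constant, which is offset by taking the radius 2Lq in w. *)
pose L := Num.max 1 (2 * (r + cabs z0)).
have L1 : 1 <= L by rewrite /L le_max lexx.
have LM : 2 * (r + cabs z0) <= L by rewrite /L le_max lexx orbT.
have q'0 : 0 <= 2 * L * q by rewrite !mulr_ge0//; lra.
have [K hK] := szasz_bound q'0.
exists (K * (2 * L) ^+ size (T 'X^N)) => k z hz.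
pose p := ((2 * L * q) ^+ k / k`!%:R)%:C%C *: T 'X^(k + N).
have pE u : cabs p.[u] = cabs (T 'X^(k + N)).[u] / k`!%:R * (2 * L * q) ^+ k.
  rewrite hornerZ cabsM cabs_real ger0_norm ?divr_ge0 ?exprn_ge0//; ring.
have half0 : 0 < 1 / 2 :> R by lra.
have sp : (size p <= size (T 'X^N) + k)%N.
  exact: leq_trans (size_scale_leq _ _) (size_TXn k).
have hz' : cabs (z - z0) <= L * (1 / 2) by have := cabsB z z0; lra.
have hp u : cabs (u - z0) <= 1 / 2 -> cabs p.[u] <= K by rewrite pE; exact: hK.
have := disc_extension half0 L1 sp hp hz'.
have L20 : 0 < (2 * L) ^+ k by rewrite exprn_gt0//; lra.
rewrite pE => h.
have {}h : cabs (T 'X^(k + N)).[z] / k`!%:R * q ^+ k <= K * (2 * L) ^+ size (T 'X^N).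
  rewrite -(ler_pM2r L20) -!mulrA -exprD.
  by move: h; rewrite exprMn [_ ^+ k * _]mulrC -!mulrA.
apply: le_trans h; rewrite ler_wpM2r ?exprn_ge0//.
rewrite hornerZ !cabsM cabsX cabsN cabs1 expr1n mul1r cabsV cabs_nat mulrC.
rewrite ler_wpM2l ?cabs_ge0// lef_pV2 ?posrE ?ltr0n ?fact_gt0// ler_nat.
elim: (N) => [|n IH]; first by rewrite addn0.
by rewrite addnS factS (leq_trans IH)// leq_pmull.
Qed.

End Growth.


(** * Approximation of the symbol *)

Section SymbolShift.
Variables (R : realType) (T : {linear {poly R[i]} -> {poly R[i]}}).
Local Notation C := R[i].

(* The w-coefficients of T_x (x^j e^(-(x - c) w)). *)
Definition symbol_at (c : C) (j : nat) : fps R :=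
  fun k => ((-1) ^+ k / k`!%:R) *: T (('X - c%:P) ^+ k * 'X^j).

Lemma symbol_at_shift c j :
  fps_mul (fps_exp c) (symbol_at 0 j) =1 symbol_at c j.
Proof.
move=> k; rewrite /fps_mul /symbol_at exprBn mulr_suml linear_sum scaler_sumr.
apply: eq_bigr => i _; rewrite /fps_exp mul_polyC scalerA subr0.
have ik : (i <= k)%N by rewrite -ltnS.
have -> : (-1) ^+ i * 'X ^+ (k - i) * c%:P ^+ i *+ 'C(k, i) * 'X^j =
    ('C(k, i)%:R * (-1) ^+ i * c ^+ i) *: ('X^(k - i) * 'X^j).
  rewrite -mul_polyC !(rmorphM (@polyC C)) !(rmorphXn (@polyC C)) rmorphN1.
  by rewrite rmorph_nat -mulr_natr; ring.
rewrite linearZ scalerA; congr (_ *: _).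
have e : 'C(k, i)%:R * (i`!%:R * (k - i)`!%:R) = k`!%:R :> C.
  by rewrite -!natrM bin_fact.
have f0 m : m`!%:R != 0 :> C by rewrite pnatr_eq0 -lt0n fact_gt0.
have sg : (-1) ^+ k * (-1) ^+ i = (-1) ^+ (k - i) :> C.
  by rewrite -{1}(subnK ik) exprD -mulrA -expr2 sqrr_sign mulr1.
rewrite -e -sg; field.
by rewrite !f0 pnatr_eq0 -lt0n bin_gt0 ik.
Qed.

Lemma symbol_at0 : symbol_at 0 0 =1 symbol T.
Proof. by move=> k; rewrite /symbol_at subr0 expr0 mulr1. Qed.

Lemma entire_symbol_at c j : entire_fps (symbol T) -> entire_fps (symbol_at c j).
Proof.
move=> hT; have h0 : entire_fps (symbol_at 0 j).
  elim: j => [|j IH]; first by apply: entire_fps_ext hT => k; rewrite symbol_at0.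
  apply: entire_fps_ext (entire_fps_deriv IH) => k; rewrite /symbol_at subr0.
  rewrite -!exprD addSnnS -scaleNr scalerA.
  congr (_ *: _); rewrite factS natrM exprS.
  by field; rewrite nat1r !pnatr_eq0 -lt0n fact_gt0.
by apply: entire_fps_ext (entire_fps_mul (entire_fps_exp c) h0); exact: symbol_at_shift.
Qed.

End SymbolShift.

Section Approximation.
Variables (R : realType) (T : {linear {poly R[i]} -> {poly R[i]}}).
Variables (mu tau s : R) (N : nat).
Local Notation C := R[i].
Local Notation D := (half_plane mu tau).
Local Notation strip := (in_strip mu).
Implicit Types (z w a b : C) (p q f g h y : {poly C}) (rs l : seq C).

Lemma geometric_sum_le (K : R) m : 0 <= K -> \sum_(k < m) K / 2 ^+ k <= 2 * K.
Proof.
move=> K0; suff -> : \sum_(k < m) K / 2 ^+ k = 2 * K - 2 * K / 2 ^+ m.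
  by rewrite gerBl divr_ge0 ?mulr_ge0 ?exprn_ge0.
elim: m => [|m IH]; first by rewrite big_ord0 expr0 divr1 subrr.
rewrite big_ord_recr /= IH exprS; field.
by rewrite expf_neq0// pnatr_eq0.
Qed.

Lemma entire_series_sum (g : fps R) z w : entire_fps g ->
  exists S : C, forall e : R, 0 < e -> exists M, forall m, (M <= m)%N ->
    cabs (S - \sum_(k < m) (g k).[z] * w ^+ k) < e.
Proof.
move=> hg; have q0 : 0 <= 2 * cabs w by rewrite mulr_ge0 ?cabs_ge0.
have [K K0 hK] := entire_fps_bound (cabs z) hg q0.
have [|S hS] := @geometric_limit R (fun k => (g k).[z] * w ^+ k) K.
  move=> k; rewrite ler_pdivlMr ?exprn_gt0// cabsM cabsX -mulrA -exprMn.
  by rewrite [cabs w * 2]mulrC; exact: hK.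
exists S => e e0; have [M hM] := two_pow_small (4 * K) e0.
by exists M => m /hM; apply: le_lt_trans; exact: hS.
Qed.

Local Notation ctr := (0 +i* (s * mu))%C.

(* T_x ((1 - (x - ctr) w / n)^n (1 - x / n)^N): the N zeros at x = n stay in the
   strip, as half_plane_nonvanishing demands, and disappear in the limit. *)
Definition approx (n : nat) : {poly {poly C}} :=
  \poly_(k < n.+1) (('C(n, k)%:R * (- n%:R^-1) ^+ k) *:
     T (('X - ctr%:P) ^+ k * (1 - n%:R^-1 *: 'X) ^+ N)).

Lemma eval2E (p : {poly {poly C}}) m z w : (size p <= m)%N ->
  eval2 p (z, w) = \sum_(k < m) (p`_k).[z] * w ^+ k.
Proof.
move=> sp; rewrite /eval2 /= (horner_coef_wide _ sp) horner_sum.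
by apply: eq_bigr => k _; rewrite !hornerE.
Qed.

Lemma eval2_approx n z w : eval2 (approx n) (z, w) =
  (T ((1 - (w / n%:R) *: ('X - ctr%:P)) ^+ n * (1 - n%:R^-1 *: 'X) ^+ N)).[z].
Proof.
rewrite (@eval2E _ n.+1) ?size_poly// linear_binomial; apply: eq_bigr => k _.
by rewrite coef_poly ltn_ord hornerZ -mulrN exprMn; ring.
Qed.

Lemma coef_approx n k z : (0 < n)%N -> ((approx n)`_k).[z] =
  (fall_ratio R n k)%:C%C *
  \sum_(j < N.+1) 'C(N, j)%:R * (- n%:R^-1) ^+ j * (symbol_at T ctr j k).[z].
Proof.
move=> n0; rewrite coef_poly.
transitivity (('C(n, k)%:R * (- n%:R^-1) ^+ k) *:
     T (('X - ctr%:P) ^+ k * (1 - n%:R^-1 *: 'X) ^+ N)).[z].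
  by case: ltnP => // nk; rewrite bin_small// mul0r scale0r.
rewrite bin_fall// hornerZ [_ ^+ k * (1 - _) ^+ N]mulrC linear_binomial -mulrA.
rewrite !mulr_sumr; apply: eq_bigr => j _.
rewrite /symbol_at hornerZ [_ ^+ k * 'X^j]mulrC; ring.
Qed.

Lemma approx_rate (F : C * C -> C) :
  entire_fps (symbol T) ->
  (forall z w (e : R), 0 < e -> exists M, forall m, (M <= m)%N ->
    cabs (F (z, w) - \sum_(k < m) (symbol_at T ctr 0 k).[z] * w ^+ k) < e) ->
  forall r : R, exists K, forall n, (0 < n)%N -> forall z w,
    cabs z <= r -> cabs w <= r -> cabs (eval2 (approx n) (z, w) - F (z, w)) <= K / n%:R.
Proof.
move=> hT hF r; have q0 : 0 <= 8 * `|r| by rewrite mulr_ge0.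
have [K K0 hK] : exists2 K, 0 <= K & forall k z, cabs z <= r ->
   (\sum_(j < N.+1) 'C(N, j)%:R * cabs (symbol_at T ctr j k).[z]) * (8 * `|r|) ^+ k <= K.
  elim: N.+1 => [|n [K K0 hK]].
    by exists 0 => // k z _; rewrite big_ord0 mul0r.
  have [K' K'0 hK'] := entire_fps_bound r (entire_symbol_at ctr n hT) q0.
  exists (K + 'C(N, n)%:R * K'); first by rewrite addr_ge0// mulr_ge0.
  move=> k z hz; rewrite big_ord_recr mulrDl lerD ?hK//= -mulrA.
  by rewrite ler_wpM2l// hK'.
exists (2 * K) => n n0 z w hz hw.
have nR : 0 < n%:R :> R by rewrite ltr0n.
have part m : (n < m)%N -> cabs (eval2 (approx n) (z, w) -
    \sum_(k < m) (symbol_at T ctr 0 k).[z] * w ^+ k) <= 2 * K / n%:R.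
  move=> nm; rewrite (@eval2E _ m); last exact: leq_trans (size_poly _ _) nm.
  rewrite -sumrB; apply: (le_trans (cabs_sum _ _ _)).
  apply: le_trans (_ : (\sum_(k < m) K / 2 ^+ k) / n%:R <= _); last first.
    by rewrite ler_wpM2r ?invr_ge0// geometric_sum_le.
  rewrite mulr_suml; apply: ler_sum => k _.
  rewrite -mulrBl cabsM cabsX coef_approx// big_ord_recl /= bin0 expr0 mulr1 mul1r.
  (* The term j = 0 is off by the factor [fall_ratio], that is by at most k^2/n; the terms j >= 1,
     collected in [S1], carry a factor 1/n. *)
  set E0 := (symbol_at T ctr 0 k).[z].
  set S1 := \sum_(j < N) _.
  have [/andP[f0 f1] f2] := fall_ratio_bounds R k n0.
  set A := \sum_(j < N) 'C(N, bump 0 j)%:R * cabs (symbol_at T ctr (bump 0 j) k).[z].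
  have A0 : 0 <= A by apply: sumr_ge0 => j _; rewrite mulr_ge0 ?cabs_ge0.
  have hS1 : cabs S1 <= A / n%:R.
    apply: (le_trans (cabs_sum _ _ _)); rewrite mulr_suml; apply: ler_sum => j _.
    rewrite !cabsM cabs_nat cabsX cabsN cabsV cabs_nat mulrAC ler_wpM2l//.
      by rewrite mulr_ge0 ?cabs_ge0.
    rewrite exprS ler_piMr ?invr_ge0// exprn_ile1 ?invr_ge0//.
    by rewrite invf_le1// ler1n.
  have hk := hK k z hz; rewrite big_ord_recl /= bin0 mul1r -/E0 -/A in hk.
  have -> : (fall_ratio R n k)%:C%C * (E0 + S1) - E0 =
     (fall_ratio R n k)%:C%C * S1 - (1 - fall_ratio R n k)%:C%C * E0.
    by rewrite rmorphB rmorph1; ring.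
  have h1 : cabs ((fall_ratio R n k)%:C%C * S1 - (1 - fall_ratio R n k)%:C%C * E0)
     <= A / n%:R + k%:R ^+ 2 / n%:R * cabs E0.
    apply: (le_trans (cabsB _ _)); rewrite !cabsM !cabs_real !ger0_norm//; last by lra.
    rewrite lerD//; first by rewrite -[leRHS]mul1r ler_pM ?cabs_ge0.
    by rewrite ler_wpM2r ?cabs_ge0//; lra.
  have h2 : A / n%:R + k%:R ^+ 2 / n%:R * cabs E0 <= 4 ^+ k * (cabs E0 + A) / n%:R.
    rewrite mulrAC -mulrDl ler_wpM2r ?invr_ge0//.
    have k2 : k%:R ^+ 2 <= 4 ^+ k :> R.
      rewrite -natrX -natrX ler_nat (_ : 4 = 2 ^ 2)%N// -expnM mulnC expnM.
      by rewrite leq_exp2r// ltnW// ltn_expl.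
    have k1 : 1 <= 4 ^+ k :> R by rewrite exprn_ege1// ler1n.
    have := cabs_ge0 E0; nra.
  apply: (@le_trans _ _ (4 ^+ k * (cabs E0 + A) / n%:R * cabs w ^+ k)).
    rewrite ler_wpM2r ?exprn_ge0 ?cabs_ge0//; exact: le_trans h1 h2.
  rewrite mulrAC ler_wpM2r ?invr_ge0// ler_pdivlMr ?exprn_gt0//.
  apply: le_trans hk.
  have -> : 4 ^+ k * (cabs E0 + A) * cabs w ^+ k * 2 ^+ k =
     (cabs E0 + A) * (8 * cabs w) ^+ k.
    by rewrite exprMn (_ : 8 = 4 * 2) ?exprMn; [ring | rewrite -natrM].
  rewrite ler_wpM2l ?addr_ge0 ?cabs_ge0// lerXn2r ?nnegrE ?mulr_ge0 ?cabs_ge0//.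
  by rewrite ler_wpM2l// (le_trans hw)// ler_norm.
(* Passage to the limit in m: a partial sum closer to F than the excess would contradict [part]. *)
rewrite leNgt; apply/negP => hlt.
have [M hM] := hF z w _ (eq_ind _ is_true hlt _ (esym (subr_gt0 _ _))).
pose m := maxn M n.+1.
have := hM m (leq_maxl _ _); have := part m (leq_maxr _ _).
set S := \sum_(k < m) _ => h1 h2.
have := cabsB (eval2 (approx n) (z, w) - S) (F (z, w) - S).
rewrite opprB addrA subrK; lra.
Qed.

Hypothesis mu_gt0 : 0 < mu.
Hypothesis tau1 : tau ^+ 2 = 1.
Hypothesis s1 : s ^+ 2 = 1.
Hypothesis T_strip : forall rs z, all strip rs -> (N <= size rs)%N ->
  D z -> (T (prodX rs)).[z] != 0.
Hypothesis T_side : forall rs z, all strip rs -> (N <= size rs)%N -> D z ->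
  mu <= s * complex.Im (shift_ratio T (prodX rs) z).

(** The centre [ctr] lies on the line s Im = mu, the extreme position allowed by
    [half_plane_binomial]; this produces the exponential factor in front of the symbol. *)
Lemma approx_neq0 n z w : (0 < n)%N -> D z -> 0 < s * complex.Im w ->
  eval2 (approx n) (z, w) != 0.
Proof.
move=> n0 hz hw; rewrite eval2_approx.
have nC : n%:R != 0 :> C by rewrite pnatr_eq0 -lt0n.
have -> : 1 - n%:R^-1 *: 'X = (- n%:R^-1) *: ('X - n%:R%:P) :> {poly C}.
  have e : (n%:R^-1)%:P * n%:R%:P = 1 :> {poly C} by rewrite -polyCM mulVf.
  by rewrite -!mul_polyC polyCN -{1}e; ring.
rewrite exprZn -prodX_nseq -scalerAr linearZ hornerZ mulf_neq0//.
  by rewrite expf_neq0// oppr_eq0 invr_eq0.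
have hst : all strip (nseq N (n%:R : C)).
  by have := strip_nseq mu_gt0 N n%:R; rewrite (rmorph_nat (real_complex R)).
apply: (half_plane_binomial mu_gt0 s1 T_strip T_side) => //.
- by rewrite /= mulrA -expr2 s1 mul1r.
- by rewrite size_nseq.
Qed.

Lemma symbol_in_bar : fps_in_bar (fps_mul (fps_exp ctr) (symbol T))
  ([set z | D z] `*` [set w | 0 < s * complex.Im w]).
Proof.
have hT := entire_symbol mu_gt0 tau1 s1 T_strip T_side.
have /choice[F hF] : forall zw : C * C, exists S : C, forall e : R, 0 < e ->
    exists M, forall m, (M <= m)%N ->
    cabs (S - \sum_(k < m) (symbol_at T ctr 0 k).[zw.1] * zw.2 ^+ k) < e.
  by move=> [z w]; apply: entire_series_sum; exact: entire_symbol_at.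
exists F.
  exists (fun n => approx n.+1); first by move=> n [z w] [hz hw]; exact: approx_neq0.
  apply/family_compactP => r e e0.
  have [K hK] := approx_rate hT (fun z w => hF (z, w)) r.
  have Ke : 0 <= `|K| / e by rewrite divr_ge0// ltW.
  have := archi_boundP Ke; set M := Num.bound _ => hM.
  exists M => n Mn z w hz hw; apply: le_lt_trans (hK n.+1 isT z w hz hw) _.
  rewrite ltr_pdivrMr ?ltr0n// mulrC -ltr_pdivrMr//.
  apply: le_lt_trans (_ : `|K| / e < _).
    by rewrite ler_pM2r ?invr_gt0// ler_norm.
  by apply: (lt_le_trans hM); rewrite ler_nat ltnW.
move=> z w; apply/cvg_cabsP => e e0; have [M hM] := hF (z, w) e e0.
exists M => m /hM; rewrite /series /= big_mkord.
congr (cabs (_ - _) < _); apply: eq_bigr => k _; rewrite -symbol_at_shift.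
by rewrite /fps_mul; under eq_bigr => i _ do rewrite symbol_at0.
Qed.

End Approximation.


(** * Differential operators preserving the absence of zeros *)

Section DiffOp.
Variable A : comNzRingType.
Implicit Types (p q : {poly A}).

(** The operator p(-d/dw) applied to q. The ring is general because it serves over C[z] and, after z
    is specialised, over C. *)
Definition diff_op p q : {poly A} := \sum_(k < size p) ((-1) ^+ k * p`_k) *: q^`(k).

Lemma diff_op_wide p q m : (size p <= m)%N ->
  diff_op p q = \sum_(k < m) ((-1) ^+ k * p`_k) *: q^`(k).
Proof.
move=> sp; rewrite /diff_op -(big_mkord xpredT (fun k => ((-1) ^+ k * p`_k) *: q^`(k))).
rewrite -(big_mkord xpredT (fun k => ((-1) ^+ k * p`_k) *: q^`(k))).
rewrite [RHS](big_cat_nat _ sp)//= [X in _ + X]big1_seq ?addr0// => k.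
by rewrite mem_index_iota => /andP[_ /andP[pk _]]; rewrite nth_default// mulr0 scale0r.
Qed.

(** Operators with constant coefficients compose like polynomials, so the zeros of p can be peeled
    off one at a time. *)
Lemma diff_opXsubC p q (y : A) :
  diff_op (('X - y%:P) * p) q = diff_op p (- q^`() - y *: q).
Proof.
have sp : (size (('X - y%:P) * p)%R <= (size p).+1)%N.
  by rewrite (leq_trans (size_polyMleq _ _))// size_XsubC.
rewrite (diff_op_wide _ sp) (@diff_op_wide p _ (size p).+1)//.
under eq_bigr => k _ do rewrite mulrBl coefB mul_polyC coefZ mulrBr scalerBl.
under [RHS]eq_bigr => k _ do
  rewrite derivnB derivnN derivnZ -derivSn scalerBr scalerN scalerA -scaleNr.
rewrite !sumrB; congr (_ - _); last by apply: eq_bigr => k _; congr (_ *: _); ring.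
rewrite big_ord_recl coefXM mulr0 scale0r add0r [RHS]big_ord_recr /=.
rewrite [p`_(size p)]nth_default// mulr0 oppr0 scale0r addr0.
apply: eq_bigr => k _.
by rewrite ?lift0 coefXM /= exprS mulN1r mulNr.
Qed.

(** At w = 0 the weights (-1)^k k! cancel the (-1)^k / k! of the symbol. *)
Lemma diff_op_at0 p q m : (size p <= m)%N ->
  (diff_op p q).[0] = \sum_(k < m) (-1) ^+ k * p`_k * (q`_k *+ k`!).
Proof.
move=> sp; rewrite (diff_op_wide _ sp) horner_sum; apply: eq_bigr => k _.
by rewrite hornerZ horner_coef0 coef_derivn addn0 ffactnn.
Qed.

End DiffOp.

Lemma diff_op_map (A B : comNzRingType) (f : {rmorphism A -> B}) (p q : {poly A}) :
  map_poly f (diff_op p q) = diff_op (map_poly f p) (map_poly f q).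
Proof.
rewrite (@diff_op_wide _ (map_poly f p) _ (size p)) ?size_poly//.
rewrite /diff_op rmorph_sum; apply: eq_bigr => k _.
by rewrite /= map_polyZ rmorphM rmorph_sign coef_map derivn_map.
Qed.

Section Lax.
Variable R : realType.
Local Notation C := R[i].
Implicit Types (z w a y : C) (p q : {poly C}) (rs ys : seq C).

Lemma deriv_prodX rs w : (forall a, a \in rs -> w != a) ->
  ((prodX rs)^`()).[w] = (prodX rs).[w] * \sum_(a <- rs) (w - a)^-1.
Proof.
elim: rs => [|a rs IH] h.
  by rewrite /prodX !big_nil mulr0 -polyC1 derivC horner0.
have wa : w - a != 0 by rewrite subr_eq0 h ?mem_head.
rewrite /prodX !big_cons -/(prodX rs) derivM derivXsubC mul1r !hornerE IH.
  by field.
by move=> b bin; rewrite h// in_cons bin orbT.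
Qed.

(* The logarithmic derivative of q at w has its imaginary part of sign -s. *)
Lemma lax_step (s : R) q y : s * complex.Im y < 0 ->
  (forall w, 0 < s * complex.Im w -> q.[w] != 0) ->
  forall w, 0 < s * complex.Im w -> (- q^`() - y *: q).[w] != 0.
Proof.
move=> hy hq w hw; have qw := hq w hw.
have q0 : q != 0 by apply: contraNneq qw => ->; rewrite horner0.
have [rs Dq hrs] := normal_form q0; rewrite -/(prodX rs) in Dq.
have wrs a : a \in rs -> w != a.
  by rewrite hrs => ra; apply: contraTneq ra => <-; rewrite rootE.
have qE : (q^`()).[w] = q.[w] * \sum_(a <- rs) (w - a)^-1.
  by rewrite {1}Dq derivZ hornerZ deriv_prodX// mulrA -hornerZ -Dq.
rewrite hornerD !hornerN hornerZ qE mulrC -mulNr -mulrBl mulf_neq0//.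
apply/eqP => /(congr1 (fun u => s * complex.Im u)).
rewrite cImD !cImN cIm_sum mulr0 mulrDr !mulrN.
have : s * \sum_(a <- rs) complex.Im (w - a)^-1 <= 0.
  rewrite mulr_sumr big_seq; apply: sumr_le0 => a ain.
  rewrite cImV mulrA mulrN mulNr oppr_le0 divr_ge0 ?sqr_ge0//.
  have : s * complex.Im a <= 0.
    rewrite leNgt; apply/negP => /hq; move: ain; rewrite hrs rootE => /eqP ->.
    by rewrite eqxx.
  by rewrite cImD cImN mulrBr; lra.
lra.
Qed.

Lemma lax (s : R) (c : C) ys q : c != 0 ->
  (forall y, y \in ys -> s * complex.Im y < 0) ->
  (forall w, 0 < s * complex.Im w -> q.[w] != 0) ->
  forall w, 0 < s * complex.Im w -> (diff_op (c *: prodX ys) q).[w] != 0.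
Proof.
move=> c0; elim: ys q => [|y ys IH] q hys hq w hw.
  rewrite (@diff_op_wide _ _ _ 1); last first.
    by rewrite /prodX big_nil (leq_trans (size_scale_leq _ _))// size_poly1.
  rewrite big_ord1 /prodX big_nil coefZ coef1 mulr1 expr0 mul1r.
  by rewrite hornerZ mulf_neq0// hq.
rewrite /prodX big_cons -/(prodX ys) scalerAr diff_opXsubC.
apply: IH => // [u uys|]; first by rewrite hys// in_cons uys orbT.
by apply: lax_step => //; rewrite hys// mem_head.
Qed.

End Lax.

(** * From zero-free approximations of the symbol to zero-free images *)

Section Sufficiency.
Variables (R : realType) (T : {linear {poly R[i]} -> {poly R[i]}}).
Variables (mu tau s : R).
Local Notation C := R[i].
Local Notation D := (half_plane mu tau).
Local Notation ctr := (0 +i* (s * mu))%C.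
Implicit Types (z w a b : C) (f g h : {poly C}) (p q : {poly {poly C}}) (rs : seq C).

Lemma eval2_near0 p (r e : R) : 0 < e -> exists2 d : R, 0 < d &
  forall w z, cabs w <= d -> cabs z <= r -> cabs (eval2 p (z, w) - (p`_0).[z]) <= e.
Proof.
move=> e0.
have [M M0 hM] : exists2 M, 0 <= M & forall z, cabs z <= r ->
    \sum_(k < size p) cabs (p`_k.+1).[z] <= M.
  elim: (size p) => [|n [M M0 hM]]; first by exists 0 => // z _; rewrite big_ord0.
  have [M' hM'] := poly_bounded (p`_n.+1) r; exists (M + `|M'|).
    by rewrite addr_ge0.
  move=> z hz; rewrite big_ord_recr /= lerD ?hM//.
  by rewrite (le_trans (hM' z hz))// ler_norm.
have M1 : 0 < M + 1 by lra.
exists (Num.min 1 (e / (M + 1))); first by rewrite lt_min ltr01 divr_gt0.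
move=> w z; rewrite le_min => /andP[w1 we] hz.
rewrite (@eval2E _ p (size p).+1)// big_ord_recl /= expr0 mulr1 addrAC subrr add0r.
rewrite (le_trans (cabs_sum _ _ _))//.
apply: (@le_trans _ _ (cabs w * M)).
  apply: le_trans (ler_wpM2l (cabs_ge0 w) (hM z hz)).
  rewrite mulr_sumr; apply: ler_sum => k _; rewrite cabsM cabsX ?lift0 exprS mulrC.
  by rewrite -mulrA ler_wpM2l ?cabs_ge0// ler_piMl ?cabs_ge0// exprn_ile1 ?cabs_ge0.
move: we; rewrite ler_pdivlMr//; have := cabs_ge0 w; nra.
Qed.

(** Convergence at w = 2 gives |u_k| <= K/2^k, hence uniform convergence on the unit disc. Cauchy's
    estimate is applied to P minus a truncation of the series; P - F and the tail contribute e
    each. *)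
Lemma coef_close (u : nat -> C) (F : C -> C) (P : {poly C}) (e : R) : 0 < e ->
  (forall w : C, series (fun k => u k * w ^+ k : C^o) @ \oo --> (F w : C^o)) ->
  (forall w, cabs w <= 1 -> cabs (P.[w] - F w) <= e) ->
  forall k, cabs (P`_k - u k) <= 2 * e.
Proof.
move=> e0 hser hP k.
have sE w n : series (fun k => u k * w ^+ k : C^o) n = \sum_(i < n) u i * w ^+ i.
  by rewrite /series /= big_mkord.
have [K hK] : exists K : R, forall i, cabs (u i) <= K / 2 ^+ i.
  have /cvg_cabsP/(_ 1 ltr01)[N hN] := hser 2.
  (* Beyond N, a term is the difference of two partial sums within 1 of the limit. *)
  exists (2 + \sum_(i < N) cabs (u i) * 2 ^+ i) => i; rewrite ler_pdivlMr ?exprn_gt0//.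
  have [iN|Ni] := ltnP i N.
    rewrite (bigD1 (Ordinal iN))//= addrCA lerDl addr_ge0// sumr_ge0// => j _.
    by rewrite mulr_ge0 ?cabs_ge0 ?exprn_ge0.
  have h1 := hN i Ni; have h2 := hN i.+1 (leqW Ni).
  rewrite !sE big_ord_recr /= in h1 h2.
  have -> : cabs (u i) * 2 ^+ i = cabs (u i * 2 ^+ i) by rewrite cabsM cabsX cabs_nat.
  set S := \sum_(j < i) u j * _ in h1 h2.
  have := cabsB (F 2 - S) (F 2 - (S + u i * 2 ^+ i)).
  have -> : F 2 - S - (F 2 - (S + u i * 2 ^+ i)) = u i * 2 ^+ i by ring.
  have : 0 <= \sum_(i < N) cabs (u i) * 2 ^+ i.
    by rewrite sumr_ge0// => j _; rewrite mulr_ge0 ?cabs_ge0 ?exprn_ge0.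
  lra.
have K0 : 0 <= K by have := hK 0%N; rewrite expr0 divr1; apply: le_trans; exact: cabs_ge0.
have rate w n : cabs w <= 1 -> cabs (F w - \sum_(i < n) u i * w ^+ i) <= 4 * K / 2 ^+ n.
  move=> w1; have [|S hS] := @geometric_limit R (fun i => u i * w ^+ i) K.
    move=> i; rewrite cabsM cabsX; apply: le_trans (hK i).
    by rewrite ler_piMr ?cabs_ge0// exprn_ile1 ?cabs_ge0.
  suff -> : F w = S by exact: hS.
  apply/eqP; rewrite -subr_eq0 -cabs_eq0 eq_le cabs_ge0 andbT leNgt; apply/negP => h0.
  have h02 : 0 < cabs (F w - S) / 2 by lra.
  have /cvg_cabsP/(_ _ h02)[N1 hN1] := hser w.
  have [N2 hN2] := two_pow_small (4 * K) h02.
  have := hN1 (maxn N1 N2) (leq_maxl _ _); have := hN2 (maxn N1 N2) (leq_maxr _ _).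
  have := hS (maxn N1 N2); rewrite sE; set X := \sum_(i < _) _.
  have := cabsB (F w - X) (S - X).
  have -> : F w - X - (S - X) = F w - S by ring.
  lra.
have [N hN] := two_pow_small (4 * K) e0.
pose M := maxn N k.+1; pose Q := P - \poly_(i < M) u i.
have -> : P`_k - u k = Q`_k.
  by rewrite coefB coef_poly leq_maxr.
have := @cauchy_estimate _ Q 1 (2 * e) k ler01; rewrite expr1n mulr1; apply=> w w1.
have -> : Q.[w] = P.[w] - F w + (F w - \sum_(i < M) u i * w ^+ i).
  by rewrite hornerD hornerN horner_poly; ring.
have w1' : cabs w <= 1 by rewrite w1.
have := cabsD (P.[w] - F w) (F w - \sum_(i < M) u i * w ^+ i).
have := hP w w1'; have := rate w M w1'; have := hN M (leq_maxl _ _); lra.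
Qed.

Lemma T_symbol_at h : T (h \Po ('X - ctr%:P)) =
  \sum_(k < size h) ((-1) ^+ k * h`_k * k`!%:R) *: symbol_at T ctr 0 k.
Proof.
rewrite comp_polyE linear_sum; apply: eq_bigr => k _.
rewrite linearZ /symbol_at scalerA expr0 mulr1; congr (_ *: _).
have f0 : k`!%:R != 0 :> C by rewrite pnatr_eq0 -lt0n fact_gt0.
have sg : (-1) ^+ k * (-1) ^+ k = 1 :> C by rewrite -expr2 sqrr_sign.
transitivity (h`_k * ((-1) ^+ k * (-1) ^+ k)); first by rewrite sg mulr1.
by field.
Qed.

Lemma symbol_atE c : fps_mul (fps_exp c) (symbol T) =1 symbol_at T c 0.
Proof.
move=> k; rewrite -symbol_at_shift /fps_mul.
by apply: eq_bigr => i _; rewrite symbol_at0.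
Qed.

Lemma eval2_map p z w : eval2 p (z, w) = (map_poly (horner_eval z) p).[w].
Proof.
rewrite (@eval2E _ p (size p))// (@horner_coef_wide _ (size p)) ?size_poly//.
by apply: eq_bigr => k _; rewrite coef_map.
Qed.

Lemma comp_poly_taylor f b :
  f \Po ('X + b%:P) = \sum_(i < size f) b ^+ i *: f^`N(i).
Proof.
rewrite /comp_poly nderiv_taylor ?size_map_polyC; last exact: mulrC.
apply: eq_bigr => i _; rewrite -mul_polyC rmorphXn mulrC nderivn_map.
by rewrite -/(comp_poly _ _) comp_polyXr.
Qed.

Lemma prodX_comp rs b :
  prodX rs \Po ('X + b%:P) = prodX [seq a - b | a <- rs].
Proof.
rewrite /prodX big_map rmorph_prod; apply: eq_bigr => a _.
by rewrite /= comp_polyB comp_polyX comp_polyC polyCB; ring.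
Qed.

Hypothesis s1 : s ^+ 2 = 1.
Hypothesis tau1 : tau ^+ 2 = 1.

Let norm_unit (x : R) : x ^+ 2 = 1 -> `|x| = 1.
Proof. by move=> x1; apply/eqP; rewrite -sqr_norm_eq1 x1. Qed.

Let cabs_ctr (x : R) : 0 <= x -> cabs (0 +i* (s * x))%C = x.
Proof. by move=> x0; rewrite cabs_imag normrM norm_unit// mul1r ger0_norm. Qed.

(** Near a zero of T f, three errors of at most eta/3 separate T f from a zero-free polynomial: a
    shift of f, the replacement of the symbol by an approximant, and a move of w off 0. This
    contradicts [hurwitz]. *)
Lemma bar_nonvanishing f :
  fps_in_bar (fps_mul (fps_exp ctr) (symbol T))
    ([set z | D z] `*` [set w | 0 < s * complex.Im w]) ->
  (forall a, root f a -> `|complex.Im a| <= mu) ->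
  T f != 0 -> forall z, D z -> ~~ root (T f) z.
Proof.
move=> [F [P hP0 /family_compactP hPF] hser] hf Tf0 z0 hz0; apply/negP => rz0.
have f0 : f != 0 by apply: contraNneq Tf0 => ->; rewrite linear0.
pose d := tau * complex.Im z0 - mu.
have d0 : 0 < d by rewrite subr_gt0.
have ballD z : cabs (z - z0) < d -> D z.
  move=> h; have h1 : `|tau * complex.Im (z - z0)| < d.
    by rewrite normrM norm_unit// mul1r (le_lt_trans (cabs_Im _)).
  move: h1; rewrite cImD cImN mulrDr mulrN ltr_norml /d /half_plane /=; lra.
pose r := cabs z0 + d.
have ballr z : cabs (z - z0) < d -> cabs z <= r.
  by have := cabsD (z - z0) z0; rewrite subrK /r; lra.
have [eta eta0 hH] := hurwitz d0 Tf0 rz0.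
have eta3 : 0 < eta / 3 by lra.
(* By Taylor's formula T (f (x + h)) is a polynomial in z and h, so [eval2_near0] makes it close to
   T f for small h. *)
pose A : {poly {poly C}} := \poly_(i < size f) T f^`N(i).
have AE z (h : C) : eval2 A (z, h) = (T (f \Po ('X + h%:P))).[z].
  rewrite comp_poly_taylor linear_sum horner_sum (@eval2E _ A (size f)) ?size_poly//.
  by apply: eq_bigr => i _; rewrite coef_poly ltn_ord linearZ hornerZ mulrC.
have A0 : A`_0 = T f by rewrite coef_poly size_poly_gt0 f0 nderivn0.
have [th th0 hth] := eval2_near0 A r eta3; rewrite A0 in hth.
(* The zeros a - h - [ctr] of [phi] satisfy s Im <= mu - th - mu < 0, as [lax] demands. *)
pose h : C := (0 +i* (s * th))%C; pose b : C := h + ctr.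
pose phi := f \Po ('X + b%:P).
have phiE : phi \Po ('X - ctr%:P) = f \Po ('X + h%:P).
  rewrite /phi -comp_polyA comp_polyD comp_polyX comp_polyC /b polyCD.
  by congr (_ \Po _); ring.
have [rs Df hrs] := normal_form f0; rewrite -/(prodX rs) in Df.
have phi_prod : phi = lead_coef f *: prodX [seq a - b | a <- rs].
  by rewrite /phi {1}Df comp_polyZ prodX_comp.
have phi_neg y : y \in [seq a - b | a <- rs] -> s * complex.Im y < 0.
  move=> /mapP[a ain ->]; rewrite cImD cImN /b cImD /= mulrBr mulrDr.
  rewrite !mulrA -expr2 s1 !mul1r.
  have : `|s * complex.Im a| <= mu by rewrite normrM norm_unit// mul1r hf// -hrs.
  by rewrite ler_norml; lra.
pose W := \sum_(k < size phi) cabs ((-1) ^+ k * phi`_k * k`!%:R).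
have W0 : 0 <= W by apply: sumr_ge0 => k _; exact: cabs_ge0.
have W1 : 0 < W + 1 by lra.
(* Errors 2 e0 in the coefficients, weighted by a total of W, add up to at most eta/3. *)
pose e0 := eta / (6 * (W + 1)).
have e00 : 0 < e0 by rewrite divr_gt0// mulr_gt0.
(* The bidisc must contain |z| <= r and the unit disc in w on which [coef_close] works. *)
have [n hn] := hPF (Num.max r 1) e0 e00; have {hn} hn := hn n (leqnn n).
have sec_coef z k : cabs z <= r ->
    cabs (((P n)`_k).[z] - (symbol_at T ctr 0 k).[z]) <= 2 * e0.
  move=> hz; have -> : ((P n)`_k).[z] = (map_poly (horner_eval z) (P n))`_k.
    by rewrite coef_map.
  apply: (coef_close (u := fun k => (symbol_at T ctr 0 k).[z])
    (F := fun w => F (z, w)) e00) => w.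
    by have := hser z w; under eq_fun => i do rewrite symbol_atE.
  move=> w1; rewrite -eval2_map ltW// hn// le_max ?hz// w1 orbT//.
pose Q := diff_op (map_poly polyC phi) (P n).
have QE z : map_poly (horner_eval z) Q = diff_op phi (map_poly (horner_eval z) (P n)).
  rewrite /Q diff_op_map; congr (diff_op _ _).
  by rewrite -map_poly_comp map_poly_id// => c _; rewrite /= /horner_eval hornerC.
have Q0 z : cabs z <= r -> cabs ((Q`_0).[z] - (T (f \Po ('X + h%:P))).[z]) <= eta / 3.
  move=> hz; have -> : (Q`_0).[z] = (diff_op phi (map_poly (horner_eval z) (P n))).[0].
    by rewrite -QE horner_coef0 coef_map.
  rewrite (diff_op_at0 _ (leqnn _)) -phiE T_symbol_at horner_sum -sumrB.
  apply: (le_trans (cabs_sum _ _ _)).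
  apply: (@le_trans _ _ (W * (2 * e0))).
    rewrite mulr_suml; apply: ler_sum => k _.
    rewrite hornerZ (_ : (map_poly _ _)`_k = ((P n)`_k).[z]); last by rewrite coef_map.
    rewrite (_ : _ - _ = (-1) ^+ k * phi`_k * k`!%:R *
      (((P n)`_k).[z] - (symbol_at T ctr 0 k).[z])); last first.
      by rewrite -[X in _ * X - _]mulr_natr; ring.
    by rewrite cabsM ler_wpM2l ?cabs_ge0//; exact: sec_coef.
  have -> : eta / 3 = (W + 1) * (2 * e0) by rewrite /e0; field; rewrite gt_eqF.
  have e2 : 0 <= 2 * e0 by lra.
  by rewrite ler_wpM2r// lerDl ler01.
have [d2 d20 hd2] := eval2_near0 Q r eta3.
(* The origin is only on the boundary of the half-plane where [lax] applies, hence a nearby interior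
   point. *)
pose w1 : C := (0 +i* (s * d2))%C.
have w1_pos : 0 < s * complex.Im w1 by rewrite /= mulrA -expr2 s1 mul1r.
apply: (hH Q.[w1%:P]) => z hz.
  rewrite rootE -[_.[z]]/(eval2 Q (z, w1)) eval2_map QE phi_prod.
  apply: (lax (s := s)) => //; first by rewrite lead_coef_eq0.
  move=> w hw; rewrite -eval2_map; apply: hP0; split => //=; exact: ballD.
have hzr := ballr z hz.
have c1 : cabs w1 <= d2 by rewrite cabs_ctr// ltW.
have c2 : cabs h <= th by rewrite cabs_ctr// ltW.
have h1 := hd2 w1 z c1 hzr; have h2 := hth h z c2 hzr.
rewrite AE in h2; have h3 := Q0 z hzr.
have := cabsD (eval2 Q (z, w1) - (Q`_0).[z])
  ((Q`_0).[z] - (T (f \Po ('X + h%:P))).[z] + ((T (f \Po ('X + h%:P))).[z] - (T f).[z])).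
have := cabsD ((Q`_0).[z] - (T (f \Po ('X + h%:P))).[z])
  ((T (f \Po ('X + h%:P))).[z] - (T f).[z]).
rewrite !addrA !subrK -[eval2 Q _]/(Q.[w1%:P].[z]); move: h1.
rewrite -[eval2 Q _]/(Q.[w1%:P].[z]); lra.
Qed.

End Sufficiency.


(** * The theorem *)

Section RankOne.
Variables (R : realType) (T : {linear {poly R[i]} -> {poly R[i]}}).
Local Notation C := R[i].

(** The functional of the rank-one form, named so that it can carry a linear structure. *)
Definition scaled_eval (z k : C) (f : {poly C}) : C := k * (T f).[z].

Fact scaled_eval_is_scalar z k : scalar (scaled_eval z k).
Proof.
move=> a f g; rewrite /scaled_eval linearD linearZ hornerD hornerZ mulrDr.
by congr (_ + _); exact: mulrCA.
Qed.

HB.instance Definition _ z k :=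
  GRing.isLinear.Build C {poly C} C *%R (scaled_eval z k) (scaled_eval_is_scalar z k).

(* With alpha f = T f (z) / T g (z), the polynomial T (f - alpha f g) vanishes
   at z, hence is 0. *)
Lemma rank_one_of_range (E : set C) z : E z ->
  (forall f, T f != 0 -> noroots E (T f)) ->
  exists (alpha : {scalar {poly C}}) (p : {poly C}),
    noroots E p /\ forall f, T f = alpha f *: p.
Proof.
move=> Ez hT; have [[g Tg0]|h0] := pselect (exists g, T g != 0); last first.
  exists (scaled_eval z 0), 1; split=> [w _|f]; first by rewrite root1.
  (* For T = 0 the functional is 0, and p = 1 supplies a polynomial without zeros. *)
  rewrite /= /scaled_eval mul0r scale0r; apply/eqP; rewrite -[_ == _]negbK.
  by apply/negP => h; apply: h0; exists f.
have Tgz : (T g).[z] != 0 by exact: hT Ez.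
exists (scaled_eval z (T g).[z]^-1), (T g); split; first exact: hT.
move=> f; apply/eqP; rewrite -subr_eq0 -linearZ -linearB; apply/negP => /negP h.
move: (hT _ h z Ez); rewrite rootE linearB linearZ hornerD hornerN hornerZ.
by rewrite /scaled_eval /= mulrAC mulVf// mul1r subrr eqxx.
Qed.

End RankOne.

(** * Polynomials with all zeros in the strip *)

Section Strip.
Variables (R : realType) (mu : R).
Local Notation C := R[i].
Implicit Types (z w a : C) (f g : {poly C}) (rs : seq C).

Lemma S_stripP f : S_strip mu f <->
  f != 0 /\ forall a, root f a -> `|complex.Im a| <= mu.
Proof.
split=> [h|[f0 h] z /= hz]; last first.
  by apply/negP => /h; rewrite leNgt hz.
split; last by move=> a ra; rewrite leNgt; apply/negP => /h; rewrite ra.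
apply/eqP => f0; have := h (0 +i* (`|mu| + 1))%C.
rewrite f0 root0 /= ger0_norm ?addr_ge0// => h'; suff: false by [].
by apply: h'; rewrite ltr_pwDr// ler_norm.
Qed.

Lemma S_stripZ (k : C) f : k != 0 -> S_strip mu (k *: f) <-> S_strip mu f.
Proof. by move=> k0; split=> h z /h; rewrite rootZ. Qed.

Lemma S_strip_prodX rs : all (in_strip mu) rs -> S_strip mu (prodX rs).
Proof.
move=> /allP hrs z /= hz; rewrite root_prod_XsubC; apply/negP => /hrs.
by rewrite /in_strip /= ltNge ltW.
Qed.

Lemma strip_margin rs : 0 < mu -> all (in_strip mu) rs ->
  exists2 d : R, 0 < d & forall a, a \in rs -> `|complex.Im a| <= mu - d.
Proof.
move=> mu0; elim: rs => [_|a rs IH] /=; first by exists mu.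
move=> /andP[ha /IH[d d0 hd]]; rewrite /in_strip /= in ha.
exists (Num.min d (mu - `|complex.Im a|)); first by rewrite lt_min d0 subr_gt0.
move=> b; rewrite in_cons => /orP[/eqP ->|/hd].
  have := ge_min (mu - `|complex.Im a|) d (mu - `|complex.Im a|).
  by rewrite lexx orbT; lra.
have := ge_min d d (mu - `|complex.Im a|).
by rewrite lexx /=; lra.
Qed.

(** Off the strip |g| <= M |[prodX rs]|, so with k = 1/(2(M + 1)) the perturbation is strictly
    smaller than the product. *)
Lemma S_strip_perturb rs g : 0 < mu -> all (in_strip mu) rs ->
  (size g <= (size rs).+1)%N ->
  exists2 k : C, k != 0 & S_strip mu (prodX rs + k *: g).
Proof.
move=> mu0 hrs sg; have [d d0 hd] := strip_margin mu0 hrs.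
have [M M0 hM] := dominated_off_strip d0 hd sg.
have e0 : 0 < (2 * (M + 1))^-1 by rewrite invr_gt0; lra.
exists ((2 * (M + 1))^-1)%:C%C.
  by rewrite (fmorph_eq0 (real_complex R)) gt_eqF.
move=> z /= hz; rewrite rootE hornerD hornerZ -cabs_gt0.
apply: lt_le_trans (cabs_lower _ _); rewrite cabsM cabs_real ger0_norm ?ltW//.
have := hM z hz; have -> : \prod_(a <- rs) cabs (z - a) = cabs (prodX rs).[z].
  by rewrite -[prodX rs]scale1r cabs_horner_prod cabs1 mul1r.
have : 0 < cabs (prodX rs).[z] by rewrite cabs_gt0 -rootE; exact: S_strip_prodX.
set x := cabs (prodX rs).[z]; set y := cabs g.[z] => x0 hy.
rewrite subr_gt0 mulrC ltr_pdivrMr; last by lra.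
by nra.
Qed.

End Strip.

(** * The half-planes of the statement in terms of signs *)

Section Regions.
Variable R : realType.
Local Notation C := R[i].

Lemma conj_setE (Omega : set C) : conj_set Omega = [set z | Omega (conjc z)].
Proof.
apply/seteqP; split=> [_ [z hz <-]|z hz] /=; first by rewrite conjcK.
by exists (conjc z); rewrite ?conjcK.
Qed.

Lemma upper_half_gtE (mu : R) : upper_half_gt mu = [set z : C | half_plane mu 1 z].
Proof. by apply/seteqP; split=> z; rewrite /upper_half_gt /half_plane /= mul1r. Qed.

Lemma conj_upper_half_gtE (mu : R) :
  conj_set (upper_half_gt mu) = [set z : C | half_plane mu (-1) z].
Proof.
rewrite conj_setE; apply/seteqP.
by split=> -[a b]; rewrite /upper_half_gt /half_plane /= mulN1r.
Qed.

Lemma upper_halfE : @upper_half R = [set w : C | 0 < 1 * complex.Im w].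
Proof. by apply/seteqP; split=> z; rewrite /upper_half /= mul1r. Qed.

Lemma conj_upper_halfE : conj_set (@upper_half R) = [set w : C | 0 < -1 * complex.Im w].
Proof.
rewrite conj_setE; apply/seteqP.
by split=> -[a b]; rewrite /upper_half /= mulN1r.
Qed.

End Regions.

Theorem theorem1p2 (R : realType) (T : {linear {poly R[i]} -> {poly R[i]}})
    (mu : R) (mu_gt0 : 0 < mu) :
  let H := @upper_half R in
  let H1 := upper_half_gt mu in
  let imu : R[i] := (0 +i* mu)%C in
  let G := symbol T in
  T @` S_strip mu `<=` S_strip mu `|` [set 0] <->
  ((range_dim_le1 T /\
    exists (alpha : {scalar {poly R[i]}}) (p : {poly R[i]}),
      noroots (H1 `|` conj_set H1) p /\ forall f, T f = alpha f *: p)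
   \/
   ((fps_in_bar (fps_mul (fps_exp imu) G) (H1 `*` H) \/
     fps_in_bar (fps_mul (fps_exp (- imu)) G) (H1 `*` conj_set H))
    /\
    (fps_in_bar (fps_mul (fps_exp imu) G) (conj_set H1 `*` H) \/
     fps_in_bar (fps_mul (fps_exp (- imu)) G)
       (conj_set H1 `*` conj_set H)))).
Proof.
move=> H H1 imu G.
have imu1 : imu = (0 +i* (1 * mu))%C by rewrite mul1r.
have imuN1 : - imu = (0 +i* (-1 * mu))%C.
  by rewrite mulN1r /imu; congr (_ +i* _)%C; rewrite oppr0.
rewrite /H1 /H conj_upper_half_gtE conj_upper_halfE upper_half_gtE upper_halfE imuN1 imu1.
have off_strip z : mu < `|complex.Im z| ->
    half_plane mu 1 z \/ half_plane mu (-1) z.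
  by rewrite ltr_normr /half_plane /= mul1r mulN1r => /orP[]; [left | right].
have in_half tau z : tau ^+ 2 = 1 -> half_plane mu tau z -> mu < `|complex.Im z|.
  move=> t1; have -> : `|complex.Im z| = `|tau * complex.Im z|.
    by rewrite normrM (_ : `|tau| = 1) ?mul1r//; apply/eqP; rewrite -sqr_norm_eq1 t1.
  by move=> h; apply: lt_le_trans h (ler_norm _).
have one1 : 1 ^+ 2 = 1 :> R by rewrite expr1n.
have mone1 : (-1) ^+ 2 = 1 :> R by rewrite sqrrN expr1n.
split=> [pres|].
  have presf f : S_strip mu f -> T f != 0 -> S_strip mu (T f).
    move=> hf Tf0; have [//|/= e] := pres (T f) (ex_intro2 _ _ f hf erefl).
    by rewrite e eqxx in Tf0.
  have [[N hN]|hN] := pselect (exists N, forall rs, all (in_strip mu) rs ->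
      (N <= size rs)%N -> T (prodX rs) != 0); [right | left].
    have bar tau : tau ^+ 2 = 1 ->
       fps_in_bar (fps_mul (fps_exp (0 +i* (1 * mu))%C) G)
         ([set z | half_plane mu tau z] `*` [set w | 0 < 1 * complex.Im w]) \/
       fps_in_bar (fps_mul (fps_exp (0 +i* (-1 * mu))%C) G)
         ([set z | half_plane mu tau z] `*` [set w | 0 < -1 * complex.Im w]).
      move=> tau1.
      have hs rs z : all (in_strip mu) rs -> (N <= size rs)%N ->
          half_plane mu tau z -> (T (prodX rs)).[z] != 0.
        move=> hrs hsz hz; rewrite -rootE.
        exact: presf (S_strip_prodX hrs) (hN _ hrs hsz) z (in_half _ _ tau1 hz).
      have [s s1 hside] := side_exists mu_gt0 tau1 hs.
      have := symbol_in_bar mu_gt0 tau1 s1 hs hside.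
      (* The side s found for rho decides which of the two alternatives holds. *)
      by have /eqP := s1; rewrite sqrf_eq1 => /orP[] /eqP ->; [left | right].
    by split; apply: bar.
  (* A product killed by T and of degree at least that of g is perturbed by k g without leaving the
     class; its image is k T g. *)
  have all_S g : T g != 0 -> S_strip mu (T g).
    move=> Tg0; have [rs [hrs hsz Trs]] : exists rs,
        [/\ all (in_strip mu) rs, (size g <= size rs)%N & T (prodX rs) = 0].
      apply: contrapT => h; apply: hN; exists (size g) => rs h1 h2.
      by apply/eqP => h3; apply: h; exists rs.
    have [k k0 hk] := S_strip_perturb mu_gt0 hrs (leq_trans hsz (leqnSn _)).
    apply/(S_stripZ _ _ k0); rewrite -linearZ -[T (k *: g)]add0r -Trs -linearD.
    by apply: presf => //; rewrite linearD Trs add0r linearZ scaler_eq0 negb_or k0.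
  have hE f : T f != 0 ->
      noroots ([set z | half_plane mu 1 z] `|` [set z | half_plane mu (-1) z]) (T f).
    by move=> /all_S h z hz; apply: h; case: hz; exact: in_half.
  have [|alpha [p [hp hT]]] := @rank_one_of_range _ T _ (0 +i* (mu + 1))%C _ hE.
    by left; rewrite /half_plane /= mul1r ltrDl.
  split; [exists p => f; exists (alpha f); exact: hT | exists alpha, p; exact: conj hp hT].
move=> [[_ [alpha [p [hp hT]]]]|[ha hb]] _ [f hf <-].
  have [a0|a0] := eqVneq (alpha f) 0; first by right; rewrite /= hT a0 scale0r.
  left; rewrite hT; apply/S_stripZ => // z hz; apply: hp.
  exact: off_strip.
have [Tf0|Tf0] := eqVneq (T f) 0; [by right | left].
have /S_stripP[_ hroot] := hf.
move=> z /off_strip[hz|hz].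
  by case: ha => h; apply: (bar_nonvanishing _ _ h).
by case: hb => h; apply: (bar_nonvanishing _ _ h).
Qed.
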